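(* Let $Q_4(x,y)=x+\frac1x+y+\frac1y+4$. Let $a,b>0$ and put $c=\sqrt{ab}$, $d=\sqrt{b/a}$, and $\mathcal{A}_{c,d}=\frac{1-d^2}{1+d^2}\cdot\frac{1+c^2}{2c}$. Then $$\mathrm{m}_{a,b}(Q_4)=\begin{cases}\max\{\log c,-\log c\}+\max\{\log d,-\log d\}, & \text{if } |\mathcal{A}_{c,d}|\ge 1,\\[4pt] \frac{2}{\pi}\Big[D(ice^{-i\mu})+D(ice^{i\mu})-\mu\log d+(\log c)\tan^{-1}\!\Big(\frac{c-c^{-1}}{2\cos\mu}\Big)\Big], & \text{if } |\mathcal{A}_{c,d}|<1,\end{cases}$$ where $\mu=\sin^{-1}(\mathcal{A}_{c,d})\in(-\frac{\pi}{2},\frac{\pi}{2})$.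
   Context: $\mathrm{m}_{a,b}(P)=\frac{1}{(2\pi i)^2}\int_{|x|=a,|y|=b}\log|P(x,y)|\frac{dx}{x}\frac{dy}{y}$ is the generalized Mahler measure over the torus $|x|=a,|y|=b$. $D$ is the Bloch–Wigner dilogarithm: $D(z)=\operatorname{Im}\big(\mathrm{Li}_2(z)+i\arg(1-z)\log|z|\big)$, with $\mathrm{Li}_2(z)=-\int_0^z\frac{\log(1-v)}{v}dv$, extended continuously to $\mathbb{C}\cup\{\infty\}$. *)

(* Defs.v *)
From HB Require Import structures.
From mathcomp Require Import all_boot all_order all_algebra.
From mathcomp Require Import all_classical all_reals all_analysis.
From mathcomp.real_closed Require Import complex.

Set Implicit Arguments.
Unset Strict Implicit.
Unset Printing Implicit Defensive.

Import Order.TTheory GRing.Theory Num.Theory.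
Import numFieldNormedType.Exports.

Local Open Scope classical_set_scope.
Local Open Scope ring_scope.
Local Open Scope complex_scope.

Section Defs.
Context {R : realType}.
Implicit Types (z x y : R[i]) (a b r theta : R).

Definition cmod z : R := ComplexField.Normc.normc z.

Definition cexpi theta : R[i] := cos theta +i* sin theta.

(* Principal argument, with values in ]-pi, pi]; the value at 0 is junk. *)
Definition carg z : R :=
  if 0 <= complex.Im z then acos (complex.Re z / cmod z)
  else - acos (complex.Re z / cmod z).

(* Principal branch, cut along the negative reals. *)
Definition clog z : R[i] := ln (cmod z) +i* carg z.

Definition cintegral (A : set R) (f : R -> R[i]) : R[i] :=
  (\int[@lebesgue_measure R]_(t in A) complex.Re (f t))
  +i* (\int[@lebesgue_measure R]_(t in A) complex.Im (f t)).

(* The path of integration is the segment v = t z, 0 <= t <= 1, so that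
   dv = z dt. *)
Definition Li2 z : R[i] :=
  - cintegral `[0, 1] (fun t => clog (1 - t%:C * z) / (t%:C * z) * z).

(* On the cut ]1, +oo[ the principal values give Im (Li2 z) = - pi log |z| and
   arg (1 - z) = pi, so the formula takes there the value 0 of the continuous
   extension. So it does at z = 1, where arg 0 is multiplied by log 1 = 0, and
   at z = 0, where arg 1 = 0. *)
Definition BlochWigner z : R :=
  complex.Im (Li2 z) + carg (1 - z) * ln (cmod z).

(* With x = a exp(i s) and y = b exp(i t), dx/x = i ds and dy/y = i dt, so
   (2 pi i)^-2 dx/x dy/y = (2 pi)^-2 ds dt. The value is an extended real and
   lne 0 = -oo; a finite value means that the integrand is summable. *)
Definition mahler a b (P : R[i] -> R[i] -> R[i]) : \bar R :=
  (((2 * pi) ^- 2)%:E *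
   \int[(@lebesgue_measure R \x @lebesgue_measure R)%E]_(w in
        `[0%R, (2 * pi)%R] `*` `[0%R, (2 * pi)%R])
      lne (cmod (P (a%:C * cexpi w.1) (b%:C * cexpi w.2)))%:E)%E.

Definition Q4 x y : R[i] := x + x^-1 + y + y^-1 + 4.

Definition calA (c d : R) : R :=
  (1 - d ^+ 2) / (1 + d ^+ 2) * ((1 + c ^+ 2) / (2 * c)).

End Defs.

(* Main.v *)
(* Put [x = w / z] and [y = w z].  Then
     w z Q4(x, y) = (w^2 + 1) (z^2 + 1) + 4 w z
                  = (1 + i w + i z (1 - i w)) (1 - i w - i z (1 + i w)),
   and [w |-> - w] turns the second factor into [1 + i w - i z (1 - i w)].  So
   the integral of [ln |Q4|] reduces, over [|w| = c] and [|z| = d], to that of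
   [ln |(1 + i w)^2 + z^2 (1 - i w)^2|], and Jensen's formula in [z^2] leaves the
   integral over [|w| = c] of [max (ln |1 + i w|, ln d + ln |1 - i w|)].  The two
   terms agree where [cos s = - calA c d], with [i w = c e^(is)].  If
   [|calA c d| >= 1], one of them dominates on the whole circle and Jensen's
   formula concludes.  Otherwise each of them dominates on an arc, and
     Im (Li2 (c e^(i phi))) = int_phi^pi ln |1 - c e^(i th)| dth
   (Fubini, applied to the radial derivative of the logarithm) expresses the two
   arc integrals by the Bloch-Wigner dilogarithm. *)
Require Import Defs.
From HB Require Import structures.
From mathcomp Require Import all_boot all_order all_algebra.
From mathcomp Require Import all_classical all_reals all_analysis.
From mathcomp.real_closed Require Import complex.
From mathcomp Require Import measurable_realfun ring lra.

Import Order.TTheory GRing.Theory Num.Theory.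
Import numFieldNormedType.Exports.

Set Implicit Arguments.
Unset Strict Implicit.
Unset Printing Implicit Defensive.

Local Open Scope classical_set_scope.
Local Open Scope ring_scope.
Local Open Scope complex_scope.

(** All manipulations are made on the nonnegative function [ln K - ln |Q4|] with values in
    [[0, +oo]], where Tonelli's theorem asks for nothing more; integrability is then read off from
    the finite value obtained. Only one-dimensional shifts of periodic functions occur: the angle of
    [y] is shifted by that of [x], and then, for a fixed difference [t] of the two angles, [s] is
    shifted by [pi / 2 + t / 2]. The angle of [z] is [t / 2], so that [z^2] carries [e^(it)].
    Jensen's formula is only needed off the zeros: the remaining [s] are finitely many in a period.
    The delicate radius is [c = 1], where [1 + i w] and [1 - i w] vanish somewhere on the circle. It
    cannot occur when [|calA c d| >= 1], and otherwise the arcs of integration stay away from the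
    singularity. *)

Section Measure.
Context {R : realType}.
Local Notation mu := (@lebesgue_measure R).
Local Open Scope ereal_scope.

(** * Affine changes of variable, periodic shifts and iterated integrals *)

Lemma measurable_affine (k s : R) :
  measurable_fun setT (fun x : measurableTypeR R => (k * x + s)%R : measurableTypeR R).
Proof. by apply: measurable_funD => //; apply: measurable_funM. Qed.

(** By uniqueness of Lebesgue measure it is enough to compare both sides on intervals []a, b]]. A
    negative [k] reverses the interval, so its preimage is closed on the left and open on the right,
    which does not affect the length. *)
Lemma lebesgue_measure_affine (k s : R) (A : set (measurableTypeR R)) :
  k != 0%R -> measurable A ->
  mu A = `|k|%R%:E *
    pushforward mu (fun x : measurableTypeR R => (k * x + s)%R : measurableTypeR R) A.
Proof.
move=> k0 mA; pose phi (x : measurableTypeR R) := (k * x + s)%R : measurableTypeR R.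
pose phi_mfun : {mfun _ >-> _} :=
  HB.pack phi (isMeasurableFun.Build _ _ _ _ phi (measurable_affine k s)).
apply: (@lebesgue_measure_unique _ (mscale (NngNum (normr_ge0 k)) (pushforward mu phi_mfun))) => //.
move=> _ [[a b]] _ <- /=; rewrite /mscale /= lebesgue_measure_itv/=.
have [k_gt0|k_lt0] := ltP 0%R k.
- have -> : pushforward mu phi `]a, b] = mu `]((a - s) / k)%R, ((b - s) / k)%R]%classic.
    congr (mu _); apply/seteqP; split => x; rewrite /phi /= !in_itv/= ltr_pdivrMr// ler_pdivlMr//;
    by rewrite ltrBlDr lerBrDr (mulrC x).
  rewrite lebesgue_measure_itv/= !lte_fin ltr_pM2r ?invr_gt0// ltrD2r.
  case: ifP => ab; last by rewrite mule0.
  by rewrite gtr0_norm// -!EFinB -EFinM; congr EFin; field.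
- have {}k_lt0 : (k < 0)%R by rewrite lt_neqAle k0.
  have -> : pushforward mu phi `]a, b] = mu `[((b - s) / k)%R, ((a - s) / k)%R[%classic.
    congr (mu _); apply/seteqP; split => x; rewrite /phi /= !in_itv/= ltr_ndivlMr// ler_ndivrMr//;
    by rewrite ltrBlDr lerBrDr (mulrC x) andbC.
  rewrite lebesgue_measure_itv/= !lte_fin ltr_nM2r ?invr_lt0// ltrD2r.
  case: ifP => ab; last by rewrite mule0.
  by rewrite ltr0_norm// -!EFinB -EFinM; congr EFin; field.
Qed.

Lemma ge0_integral_affine (k s : R) (D : set R) (f : R -> \bar R) :
  k != 0%R -> measurable D -> measurable_fun setT f -> (forall x, 0 <= f x) ->
  \int[mu]_(x in D) f x =
  \int[mu]_(x in (fun x => (k * x + s)%R) @^-1` D) (`|k|%R%:E * f (k * x + s)%R).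
Proof.
move=> k0 mD mf f0; pose phi (x : measurableTypeR R) := (k * x + s)%R : measurableTypeR R.
pose phi_mfun : {mfun _ >-> _} :=
  HB.pack phi (isMeasurableFun.Build _ _ _ _ phi (measurable_affine k s)).
have mphiD : measurable (phi @^-1` D).
  by rewrite -(setTI (_ @^-1` _)); exact: measurable_affine.
rewrite (eq_measure_integral (mscale (NngNum (normr_ge0 k)) (pushforward mu phi_mfun))); last first.
  by move=> A mA _; exact: lebesgue_measure_affine.
rewrite ge0_integral_mscale//; last exact: measurable_funTS.
rewrite ge0_integral_pushforward//; last exact: measurable_funTS.
rewrite ge0_integralZl//.
by apply: measurable_funTS; apply: measurableT_comp => //; exact: measurable_affine.
Qed.

(** An integral is the difference of those of the positive and negative parts, and the nonnegative
    case applies to each; infinite integrals are thus covered. *)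
Lemma integral_affine (k s : R) (D : set R) (f : R -> \bar R) :
  k != 0%R -> measurable D -> measurable_fun setT f ->
  \int[mu]_(x in D) f x =
  \int[mu]_(x in (fun x => (k * x + s)%R) @^-1` D) (`|k|%R%:E * f (k * x + s)%R).
Proof.
move=> k0 mD mf; rewrite integralE [RHS]integralE.
rewrite ge0_funeposM// ge0_funenegM//.
rewrite (@ge0_integral_affine k s D f^\+)//; last exact: measurable_funepos.
rewrite (@ge0_integral_affine k s D f^\-)//; last exact: measurable_funeneg.
by congr (_ - _); apply: eq_integral => x _; rewrite ?funeposE ?funenegE.
Qed.

Lemma integral_translate (s a b : R) (f : R -> \bar R) : measurable_fun setT f ->
  \int[mu]_(x in `[a, b]) f (x + s)%R =
  \int[mu]_(x in `[(a + s)%R, (b + s)%R]) f x.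
Proof.
move=> mf; rewrite [RHS](@integral_affine 1%R s)// ?oner_neq0//.
rewrite [X in _ = integral _ X _](_ : _ = `[a, b]%classic); last first.
  by apply/seteqP; split => x; rewrite /= !in_itv/= mul1r !lerD2r.
by apply: eq_integral => x _; rewrite normr1 mul1e mul1r.
Qed.

Lemma integral_reflect (s a b : R) (f : R -> \bar R) : measurable_fun setT f ->
  \int[mu]_(x in `[(s - b)%R, (s - a)%R]) f (s - x)%R = \int[mu]_(x in `[a, b]) f x.
Proof.
move=> mf; rewrite [RHS](@integral_affine (-1)%R s)// ?oppr_eq0 ?oner_neq0//.
rewrite [X in _ = integral _ X _](_ : _ = `[(s - b)%R, (s - a)%R]%classic); last first.
  by apply/seteqP; split => x; rewrite /= !in_itv/= => /andP[? ?]; apply/andP; split; lra.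
by apply: eq_integral => x _; rewrite normrN1 mul1e mulN1r addrC.
Qed.

Lemma ge0_integral_itv_split (a c b : R) (f : R -> \bar R) : (a <= c <= b)%R ->
  measurable_fun setT f -> (forall x, 0 <= f x) ->
  \int[mu]_(x in `[a, b]) f x =
  \int[mu]_(x in `[a, c]) f x + \int[mu]_(x in `[c, b]) f x.
Proof.
move=> /andP[ac cb] mf f0.
rewrite (@itv_bndbnd_setU _ _ _ (BRight c))// ge0_integral_setU//=; last 2 first.
- exact: measurable_funTS.
- by apply/disj_setPRL => x /=; rewrite !in_itv/= => /andP[cx _] /andP[_ /le_lt_trans/(_ cx)]; rewrite ltxx.
by rewrite (@integral_itv_obnd_cbnd _ c)//; exact: measurable_funTS.
Qed.

Lemma ge0_integral_periodic_shift (T s : R) (f : R -> \bar R) : (0 <= s <= T)%R ->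
  measurable_fun setT f -> (forall x, 0 <= f x) -> (forall x, f (x + T)%R = f x) ->
  \int[mu]_(x in `[0%R, T]) f (x + s)%R = \int[mu]_(x in `[0%R, T]) f x.
Proof.
move=> /andP[s0 sT] mf f0 fT; rewrite integral_translate// add0r.
rewrite (@ge0_integral_itv_split _ T)//; last by rewrite sT lerDl.
(* The part of the shifted period beyond [T] is carried back to [[0, s]] by periodicity. *)
have -> : \int[mu]_(x in `[T, (T + s)%R]) f x = \int[mu]_(x in `[0%R, s]) f x.
  have := @integral_translate T 0 s f mf; rewrite add0r addrC => <-.
  by apply: eq_integral => x _; rewrite fT.
by rewrite addeC -(@ge0_integral_itv_split _ s)// s0.
Qed.

Lemma integral_periodic_shift (T s : R) (f : R -> \bar R) : (0 <= s <= T)%R ->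
  measurable_fun setT f -> (forall x, f (x + T)%R = f x) ->
  \int[mu]_(x in `[0%R, T]) f (x + s)%R = \int[mu]_(x in `[0%R, T]) f x.
Proof.
move=> sT mf fT; rewrite integralE [RHS]integralE.
rewrite -(@ge0_integral_periodic_shift T s f^\+)//; last 2 first.
- exact: measurable_funepos.
- by move=> x; rewrite !funeposE fT.
rewrite -(@ge0_integral_periodic_shift T s f^\-)//; last 2 first.
- exact: measurable_funeneg.
- by move=> x; rewrite !funenegE fT.
by congr (_ - _); apply: eq_integral => x _; rewrite ?funeposE ?funenegE.
Qed.

(** Tonelli's theorem for [f] extended by zero outside the rectangle: the inner integrals of the
    extension are those over [B] or [A], again extended by zero. *)
Lemma ge0_integral_rect (A B : set R) (f : R * R -> \bar R) :
  measurable A -> measurable B -> measurable_fun setT f -> (forall x, 0 <= f x) ->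
  \int[mu \x mu]_(w in A `*` B) f w = \int[mu]_(x in A) \int[mu]_(y in B) f (x, y) /\
  \int[mu]_(x in A) \int[mu]_(y in B) f (x, y) =
  \int[mu]_(y in B) \int[mu]_(x in A) f (x, y).
Proof.
move=> mA mB mf f0; have mAB : measurable (A `*` B) by exact: measurableX.
have mg : measurable_fun setT (f \_ (A `*` B)).
  by apply/(measurable_restrictT _ mAB); exact: measurable_funTS.
have g0 x : 0 <= (f \_ (A `*` B)) x by rewrite patchE; case: ifP.
have gl x : \int[mu]_y (f \_ (A `*` B)) (x, y) =
    ((fun x => \int[mu]_(y in B) f (x, y)) \_ A) x.
  rewrite patchE; case: ifPn => xA.
    rewrite [RHS]integral_mkcond; apply: eq_integral => y _.
    by rewrite !patchE in_setX xA.
  by apply: integral0_eq => y _; rewrite patchE in_setX (negbTE xA).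
have gr y : \int[mu]_x (f \_ (A `*` B)) (x, y) =
    ((fun y => \int[mu]_(x in A) f (x, y)) \_ B) y.
  rewrite patchE; case: ifPn => yB.
    rewrite [RHS]integral_mkcond; apply: eq_integral => x _.
    by rewrite !patchE in_setX yB andbT.
  by apply: integral0_eq => x _; rewrite patchE in_setX (negbTE yB) andbF.
split.
  rewrite integral_mkcond fubini_tonelli1// [RHS]integral_mkcond.
  by apply: eq_integral => x _; rewrite /fubini_F gl.
rewrite integral_mkcond [RHS]integral_mkcond.
transitivity (\int[mu]_x \int[mu]_y (f \_ (A `*` B)) (x, y)).
  by apply: eq_integral => x _; rewrite gl.
rewrite fubini_tonelli//.
by apply: eq_integral => x _; rewrite gr.
Qed.

Lemma measurable_integral_section (B : set R) (f : R * R -> \bar R) :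
  measurable B -> measurable_fun setT f -> (forall x, 0 <= f x) ->
  measurable_fun setT (fun x => \int[mu]_(y in B) f (x, y)).
Proof.
move=> mB mf f0; have mTB : measurable (setT `*` B : set (R * R)) by exact: measurableX.
rewrite (_ : (fun x => _) = fun x => \int[mu]_y (f \_ (setT `*` B)) (x, y)); last first.
  apply/funext => x; rewrite [LHS]integral_mkcond; apply: eq_integral => y _.
  by rewrite !patchE in_setX in_setT.
apply: (measurable_fun_fubini_tonelli_F (m2 := mu) (f \_ (setT `*` B))) => [|x].
  by apply/(measurable_restrictT _ mTB); exact: measurable_funTS.
by rewrite patchE; case: ifP.
Qed.

Lemma integral_rect_swap (A B : set R) (f : R * R -> \bar R) :
  measurable A -> measurable B ->
  (mu \x mu).-integrable (A `*` B) f ->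
  \int[mu]_(x in A) \int[mu]_(y in B) f (x, y) =
  \int[mu]_(y in B) \int[mu]_(x in A) f (x, y).
Proof.
move=> mA mB If; have mAB : measurable (A `*` B) by exact: measurableX.
transitivity (\int[mu]_x \int[mu]_y (f \_ (A `*` B)) (x, y)).
  rewrite integral_mkcond; apply: eq_integral => x _.
  rewrite patchE; case: ifPn => xA.
    rewrite integral_mkcond; apply: eq_integral => y _.
    by rewrite !patchE in_setX xA.
  by apply/esym/integral0_eq => y _; rewrite patchE in_setX (negbTE xA).
have If' : (mu \x mu).-integrable setT (f \_ (A `*` B)).
  exact: (iffLR (@integrable_mkcond _ _ R (mu \x mu) (A `*` B) f (measurableX mA mB)) If).
rewrite (Fubini If').
rewrite [RHS]integral_mkcond; apply: eq_integral => y _.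
rewrite patchE; case: ifPn => yB.
  rewrite [RHS]integral_mkcond; apply: eq_integral => x _.
  by rewrite !patchE in_setX yB andbT.
by apply: integral0_eq => x _; rewrite patchE in_setX (negbTE yB) andbF.
Qed.

End Measure.

(** * Jensen's formula for a polynomial of degree one *)

Section Jensen.
Context {R : realType}.
Local Notation mu := (@lebesgue_measure R).
Implicit Types (rho t : R).

Lemma measurable_cos : measurable_fun setT (@cos R).
Proof. exact: continuous_measurable_fun (@continuous_cos R). Qed.

Lemma measurable_sin : measurable_fun setT (@sin R).
Proof. exact: continuous_measurable_fun (@continuous_sin R). Qed.

Lemma integrable_itv_bounded (a b C : R) (f : R -> R) : measurable_fun setT f ->
  {in `[a, b], forall x, `|f x| <= C} -> mu.-integrable `[a, b] (EFin \o f).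
Proof.
move=> mf fC; apply: measurable_bounded_integrable => //.
- by rewrite /= lebesgue_measure_itv/=; case: ifP => _; rewrite ?ltey.
- exact: measurable_funTS.
- exists C; split; first exact: num_real.
  by move=> x Cx y /= yab; apply: le_trans (ltW Cx); apply: fC.
Qed.

Lemma EFin_Rintegral (a b : R) (f : R -> R) : mu.-integrable `[a, b] (EFin \o f) ->
  (\int[mu]_(x in `[a, b]) (f x)%:E)%E = (\int[mu]_(x in `[a, b]) f x)%:E.
Proof. by move=> If; rewrite /Rintegral fineK//; apply: integrable_fin_num. Qed.

Lemma integral_add_scale (al be l : R) (f : R -> R) : 0 < l ->
  mu.-integrable `[0, l] (EFin \o f) ->
  (\int[mu]_(x in `[0%R, l]) (al + be * f x)%:E =
   (al * l + be * \int[mu]_(x in `[0, l]) f x)%R%:E)%E.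
Proof.
move=> l0 If.
have Ia : mu.-integrable `[0, l] (EFin \o (fun=> al)).
  exact: (@integrable_itv_bounded _ _ `|al|).
have Ib : mu.-integrable `[0, l] (EFin \o (fun x => be * f x)).
  rewrite (_ : _ \o _ = (fun x => be%:E * (EFin \o f) x)%E); first exact: integrableZl.
  by apply/funext => x /=; rewrite EFinM.
rewrite EFin_Rintegral; last first.
  rewrite (_ : _ \o _ = ((EFin \o (fun=> al)) \+ (EFin \o (fun x => be * f x)%R))%E).
    exact: integrableD.
  by apply/funext => x /=; rewrite EFinD.
rewrite RintegralD// RintegralZl// Rintegral_cst//= lebesgue_measure_itv/= lte_fin l0.
by rewrite sube0.
Qed.

Lemma Rintegral_itv_split (a c b : R) (f : R -> R) : a <= c <= b ->
  mu.-integrable `[a, b] (EFin \o f) ->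
  \int[mu]_(x in `[a, b]) f x =
  \int[mu]_(x in `[a, c]) f x + \int[mu]_(x in `[c, b]) f x.
Proof.
move=> /andP[ac cb] If; apply/eqP; rewrite addrC -subr_eq; apply/eqP.
rewrite Rintegral_itvB ?bnd_simp// Rintegral_itv_obnd_cbnd//.
apply: integrableS If => //= x /=; rewrite !in_itv/= => /andP[? ?].
by apply/andP; split; lra.
Qed.

Lemma Rintegral_translate (s a b : R) (f : R -> R) : measurable_fun setT f ->
  \int[mu]_(x in `[a, b]) f (x + s) = \int[mu]_(x in `[a + s, b + s]) f x.
Proof.
by move=> mf; rewrite /Rintegral -(@integral_translate _ s a b (EFin \o f))//; exact/measurable_EFinP.
Qed.

Lemma Rintegral_reflect (s a b : R) (f : R -> R) : measurable_fun setT f ->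
  \int[mu]_(x in `[s - b, s - a]) f (s - x) = \int[mu]_(x in `[a, b]) f x.
Proof.
by move=> mf; rewrite /Rintegral -(@integral_reflect _ s a b (EFin \o f))//; exact/measurable_EFinP.
Qed.

Lemma Rintegral_double (a : R) (f : R -> R) : measurable_fun setT f ->
  mu.-integrable `[0, a] (EFin \o (fun x => f (2 * x))) ->
  \int[mu]_(x in `[0, 2 * a]) f x = 2 * \int[mu]_(x in `[0, a]) f (2 * x).
Proof.
move=> mf If; rewrite -RintegralZl// /Rintegral.
rewrite (@integral_affine _ 2 0 _ (EFin \o f))//; last exact/measurable_EFinP.
rewrite [X in fine (integral _ X _) = _](_ : _ = `[0, a]%classic); last first.
  by apply/seteqP; split => x; rewrite /= !in_itv/= => /andP[? ?]; apply/andP; split; lra.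
congr fine; apply: eq_integral => x _ /=.
by rewrite addr0 ger0_norm.
Qed.

(* [ln |1 - rho e^(it)|] *)
Definition lncirc rho t : R := ln (1 + rho ^+ 2 - 2 * rho * cos t) / 2.

Lemma measurable_lncirc rho : measurable_fun setT (lncirc rho).
Proof.
apply: measurable_funM => //; apply: measurableT_comp => //.
by apply: measurable_funB => //; apply: measurable_funM => //; exact: measurable_cos.
Qed.

Lemma circ_ge rho t : 0 <= rho -> (1 - rho) ^+ 2 <= 1 + rho ^+ 2 - 2 * rho * cos t.
Proof. by move=> r0; have := cos_le1 t; nra. Qed.

Lemma circ_le rho t : 0 <= rho -> 1 + rho ^+ 2 - 2 * rho * cos t <= (1 + rho) ^+ 2.
Proof. by move=> r0; have := cos_geN1 t; nra. Qed.

(** [1 - rho <= |1 - rho e^(it)| <= 1 + rho <= (1 - rho)^-1], the last because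
    [(1 + rho) (1 - rho) <= 1]. The bound increases with [rho], so one constant serves for all
    smaller radii. *)
Lemma lncirc_bound rho t : 0 <= rho < 1 -> `|lncirc rho t| <= - ln (1 - rho).
Proof.
move=> /andP[r0 r1]; have r1' : 0 < 1 - rho by rewrite subr_gt0.
have h0 : 0 < 1 + rho ^+ 2 - 2 * rho * cos t.
  by apply: lt_le_trans (circ_ge t r0); rewrite exprn_gt0.
have l1 : ln ((1 - rho) ^+ 2) <= ln (1 + rho ^+ 2 - 2 * rho * cos t).
  by rewrite ler_ln ?posrE ?exprn_gt0//; exact: circ_ge.
have l2 : ln (1 + rho ^+ 2 - 2 * rho * cos t) <= ln ((1 - rho) ^- 2).
  rewrite ler_ln ?posrE ?invr_gt0 ?exprn_gt0//.
  apply: le_trans (circ_le t r0) _; rewrite -[leRHS]mul1r ler_pdivlMr ?exprn_gt0//.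
  by rewrite -exprMn exprn_ile1//; nra.
rewrite lnV ?posrE ?exprn_gt0// in l2; rewrite lnXn// mulr2n in l1 l2.
by rewrite /lncirc ler_norml; apply/andP; split; lra.
Qed.

(** A lower bound [m] of the squared modulus replaces [rho < 1]: this serves for [rho > 1] on the
    whole circle and for [rho = 1] on arcs away from the angle [0]. *)
Lemma lncirc_bound_gen rho t (m : R) : 0 <= rho -> 0 < m ->
  m <= 1 + rho ^+ 2 - 2 * rho * cos t ->
  `|lncirc rho t| <= (`|ln m| + `|ln ((1 + rho) ^+ 2)|) / 2.
Proof.
move=> r0 m0 mv; have v0 := lt_le_trans m0 mv.
have l1 : ln m <= ln (1 + rho ^+ 2 - 2 * rho * cos t) by rewrite ler_ln ?posrE.
have l2 : ln (1 + rho ^+ 2 - 2 * rho * cos t) <= ln ((1 + rho) ^+ 2).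
  by rewrite ler_ln ?posrE ?circ_le// exprn_gt0//; lra.
rewrite /lncirc normrM [`|2^-1|]ger0_norm// ler_pM2r ?invr_gt0// ler_norml.
have := ler_norm (ln ((1 + rho) ^+ 2)); have := ler_norm (- ln m).
have := normr_ge0 (ln ((1 + rho) ^+ 2)); have := normr_ge0 (ln m).
by rewrite normrN => *; apply/andP; split; lra.
Qed.

Lemma integrable_lncirc rho (a b : R) : 0 <= rho -> rho != 1 ->
  mu.-integrable `[a, b] (EFin \o lncirc rho).
Proof.
move=> r0 r1; apply: integrable_itv_bounded; first exact: measurable_lncirc.
move=> t _; apply: (lncirc_bound_gen r0 _ (circ_ge t r0)).
by rewrite exprn_even_gt0//= subr_eq0 eq_sym.
Qed.

(** From [1 - rho e^(it) = - rho e^(it) (1 - rho^-1 e^(-it))]; it carries Jensen's formula from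
    radii below [1] to radii above. *)
Lemma lncircV rho t : 0 < rho -> rho != 1 ->
  lncirc rho t = ln rho + lncirc rho^-1 t.
Proof.
move=> r0 r1; have h0 : 0 < 1 + rho^-1 ^+ 2 - 2 * rho^-1 * cos t.
  apply: lt_le_trans (circ_ge t _); last by rewrite invr_ge0 ltW.
  by rewrite exprn_even_gt0//= subr_eq0 eq_sym invr_eq1.
rewrite /lncirc (_ : 1 + _ - _ = rho ^+ 2 * (1 + rho^-1 ^+ 2 - 2 * rho^-1 * cos t)).
  by rewrite lnM ?posrE ?exprn_gt0// lnXn// mulr2n; field.
by field; rewrite gt_eqF.
Qed.

(** From [(1 - rho e^(it)) (1 + rho e^(it)) = 1 - rho^2 e^(2it)]. *)
Lemma lncirc_sqr rho t : 0 <= rho < 1 ->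
  lncirc rho t + lncirc rho (t + pi) = lncirc (rho ^+ 2) (2 * t).
Proof.
move=> /andP[r0 r1]; rewrite /lncirc -mulrDl -lnM; last 2 first.
- by rewrite posrE; apply: lt_le_trans (circ_ge _ r0); rewrite exprn_gt0// subr_gt0.
- by rewrite posrE; apply: lt_le_trans (circ_ge _ r0); rewrite exprn_gt0// subr_gt0.
have -> : cos (2 * t) = 2 * cos t ^+ 2 - 1 by rewrite mulr_natl cos_mulr2n; ring.
by congr (ln _ / _); rewrite cosDpi; ring.
Qed.

(** Folding the circle onto a half and doubling the angle gives [J r = J (r ^+ 2) / 2]. Since [J] is
    bounded on [[0, rho]] by some [C], iteration yields [|J rho| <= C / 2 ^+ n] for every [n]. *)
Lemma Rintegral_lncirc_lt1 rho : 0 <= rho < 1 ->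
  \int[mu]_(t in `[0, 2 * pi]) lncirc rho t = 0.
Proof.
pose J r := \int[mu]_(t in `[0, 2 * pi]) lncirc r t.
have pi0 := @pi_gt0 R.
have I r a b : 0 <= r < 1 -> mu.-integrable `[a, b] (EFin \o lncirc r).
  move=> r01; apply: (@integrable_itv_bounded _ _ (- ln (1 - r))).
    exact: measurable_lncirc.
  by move=> x _; exact: lncirc_bound.
have sq r : 0 <= r < 1 -> 0 <= r ^+ 2 < 1.
  by move=> /andP[r0 r1]; rewrite exprn_ge0//= expr_lt1.
have JJ r : 0 <= r < 1 -> J r = J (r ^+ 2) / 2.
  move=> r01; rewrite /J (@Rintegral_itv_split _ pi)//; last 2 first.
  - by apply/andP; split; lra.
  - exact: I.
  rewrite Rintegral_double; last 2 first.
  - exact: measurable_lncirc.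
  - apply: (@integrable_itv_bounded _ _ (- ln (1 - r ^+ 2))).
      apply: measurableT_comp; first exact: measurable_lncirc.
      exact: measurable_funM.
    by move=> x _; apply: lncirc_bound; exact: sq.
  rewrite [RHS]mulrC mulKf//.
  rewrite [X in _ + \int[_]_(t in X) _](_ : _ = `[0 + pi, pi + pi]%classic); last first.
    by rewrite add0r mulr_natl mulr2n.
  rewrite -Rintegral_translate; last exact: measurable_lncirc.
  rewrite -RintegralD//; last 2 first.
  - exact: I.
  - apply: (@integrable_itv_bounded _ _ (- ln (1 - r))).
      apply: measurableT_comp; first exact: measurable_lncirc.
      exact: measurable_funD.
    by move=> x _; exact: lncirc_bound.
  by apply: eq_Rintegral => t _; rewrite lncirc_sqr.
have Jb r : 0 <= r < 1 -> `|J r| <= - ln (1 - r) * (2 * pi).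
  move=> r01; apply: le_trans (le_normr_Rintegral _ _) _ => //; first exact: I.
  have -> : - ln (1 - r) * (2 * pi) = \int[mu]_(t in `[0, 2 * pi]) (- ln (1 - r)).
    rewrite Rintegral_cst//= lebesgue_measure_itv/= lte_fin.
    by rewrite ifT ?sube0//; lra.
  apply: le_Rintegral => //; first exact/integrable_norm/I.
    by apply: (@integrable_itv_bounded _ _ `|- ln (1 - r)|) => // x _.
  by move=> x _; exact: lncirc_bound.
move=> r01; set C := - ln (1 - rho) * (2 * pi).
(* The bound is stated for all [r <= rho] because the induction passes from [r] to [r ^+ 2 <= r]. *)
have JC n r : 0 <= r <= rho -> `|J r| <= C / 2 ^+ n.
  have [rho0 rho1] := andP r01.
  elim: n r => [|n IH] r /andP[r0 rrho].
    have rr : 0 <= r < 1 by rewrite r0 (le_lt_trans rrho).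
    rewrite expr0 divr1; apply: le_trans (Jb r rr) _.
    rewrite ler_wpM2r//; first by lra.
    by rewrite lerN2 ler_ln ?posrE ?subr_gt0//; lra.
  rewrite JJ; last by rewrite r0 (le_lt_trans rrho).
  rewrite (_ : C / 2 ^+ n.+1 = C / 2 ^+ n / 2); last by rewrite exprSr invfM mulrA.
  rewrite normrM [`|2^-1|]ger0_norm// ler_wpM2r//.
  by apply: IH; rewrite exprn_ge0//=; apply: (le_trans _ rrho); rewrite expr2 ler_piMr//; lra.
apply/eqP; rewrite -/(J rho) -normr_eq0; apply/contraT => J0.
have {}J0 : 0 < `|J rho| by rewrite lt_def J0/=.
have := archi_boundP (divr_ge0 (le_trans (normr_ge0 _) (Jb _ r01)) (ltW J0)).
set n := Num.bound _ => hn.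
have := JC n rho; rewrite lexx andbT => /(_ (andP r01).1).
rewrite ler_pdivlMr ?exprn_gt0// leNgt; case/negP.
rewrite -/C ltr_pdivrMr// [ltRHS]mulrC in hn; apply: lt_le_trans hn _.
by rewrite ler_pM2l// -natrX ler_nat ltnW// ltn_expl.
Qed.

(* Jensen's formula for the polynomial [1 - rho z] on the unit circle *)
Lemma Rintegral_lncirc rho : 0 < rho -> rho != 1 ->
  \int[mu]_(t in `[0, 2 * pi]) lncirc rho t = 2 * pi * Num.max 0 (ln rho).
Proof.
move=> r0 r1; have [rlt|rgt] := ltP rho 1.
  rewrite Rintegral_lncirc_lt1 ?(ltW r0)// max_l ?mulr0//.
  by rewrite -ln1 ler_ln ?posrE// ltW.
have {}rgt : 1 < rho by rewrite lt_def r1.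
have rV : 0 <= rho^-1 < 1 by rewrite invr_ge0 ltW//= invf_lt1.
under eq_Rintegral do rewrite lncircV//.
rewrite RintegralD//; last 2 first.
- by apply: (@integrable_itv_bounded _ _ `|ln rho|).
- apply: (@integrable_itv_bounded _ _ (- ln (1 - rho^-1))); first exact: measurable_lncirc.
  by move=> x _; exact: lncirc_bound.
rewrite Rintegral_lncirc_lt1// addr0 Rintegral_cst//= lebesgue_measure_itv/= lte_fin.
rewrite ifT; last by have := @pi_gt0 R; lra.
rewrite sube0 max_r/=; first by rewrite mulrC.
by rewrite ln_ge0// ltW.
Qed.

End Jensen.

(** * Derivatives of explicit expressions and the fundamental theorem of calculus *)

Section Calculus.
Context {R : realType}.
Local Notation mu := (@lebesgue_measure R).
Implicit Types (f g F : R -> R) (x : R).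

Lemma is_derive1_cst (c x : R) : is_derive x 1 (fun _ : R => c) 0.
Proof. exact: is_derive_cst. Qed.

Lemma is_derive1_idfun x : is_derive x 1 (fun y : R => y) 1.
Proof. exact: is_derive_id. Qed.

(** Lets a derivative be assembled mechanically, its closed form being proved afterwards by
    [field]. *)
Lemma is_derive1_eq f x (a b : R) : is_derive x 1 f a -> a = b -> is_derive x 1 f b.
Proof. by move=> ? <-. Qed.

Lemma is_derive1D f g x (a b : R) : is_derive x 1 f a -> is_derive x 1 g b ->
  is_derive x 1 (fun y => f y + g y) (a + b).
Proof. by move=> fa gb; exact: is_deriveD. Qed.

Lemma is_derive1N f x (a : R) : is_derive x 1 f a -> is_derive x 1 (fun y => - f y) (- a).
Proof. by move=> fa; exact: is_deriveN. Qed.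

Lemma is_derive1B f g x (a b : R) : is_derive x 1 f a -> is_derive x 1 g b ->
  is_derive x 1 (fun y => f y - g y) (a - b).
Proof. by move=> fa gb; exact: is_deriveB. Qed.

Lemma is_derive1M f g x (a b : R) : is_derive x 1 f a -> is_derive x 1 g b ->
  is_derive x 1 (fun y => f y * g y) (a * g x + f x * b).
Proof.
move=> fa gb; have -> : a * g x + f x * b = f x *: b + g x *: a.
  by rewrite /GRing.scale/= addrC [g x * a]mulrC.
exact: (@is_deriveM _ _ f g x 1 a b fa gb).
Qed.

Lemma is_derive1V f x (a : R) : f x != 0 -> is_derive x 1 f a ->
  is_derive x 1 (fun y => (f y)^-1) (- a / f x ^+ 2).
Proof.
move=> fx fa; have -> : - a / f x ^+ 2 = - f x ^- 2 *: a.
  by rewrite /GRing.scale/= mulrC mulNr mulrN.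
exact: is_deriveV.
Qed.

Lemma is_derive1_continuous f x (a : R) : is_derive x 1 f a -> {for x, continuous f}.
Proof.
by move=> [df _]; apply: differentiable_continuous; exact/derivable1_diffP.
Qed.

Lemma continuous_FTC2_closed F f (a b : R) : a < b ->
  {in `[a, b], forall x, is_derive x 1 F (f x)} ->
  {in `[a, b], forall x, {for x, continuous f}} ->
  (\int[mu]_(x in `[a, b]) (f x)%:E)%E = (F b - F a)%:E.
Proof.
move=> ab dF cf; rewrite EFinB; apply: continuous_FTC2 => //.
- by apply: continuous_in_subspaceT => x; rewrite inE/=; exact: cf.
- split.
  + by move=> x xab; have [] := dF x (subset_itv_oo_cc xab).
  + apply: cvg_at_right_filter; apply: is_derive1_continuous (dF a _).
    by rewrite in_itv/= lexx ltW.
  + apply: cvg_at_left_filter; apply: is_derive1_continuous (dF b _).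
    by rewrite in_itv/= lexx ltW.
- move=> x xab; rewrite derive1E.
  by have [_] := dF x (subset_itv_oo_cc xab).
Qed.

End Calculus.

(** * The argument and modulus of [1 - u e^(i phi)] and the integrand of [Li2] *)

Section Dilogarithm.
Context {R : realType}.
Local Notation mu := (@lebesgue_measure R).
Implicit Types (c u t phi : R).

(* [- arg (1 - u e^(i phi))] for [0 <= u] and [0 < phi < 2 pi] *)
Definition circarg u phi : R :=
  (pi - phi) / 2 - atan ((1 - u) / (1 + u) * (cos (phi / 2) / sin (phi / 2))).

Lemma circ_gt0 u t : 0 <= u -> cos t != 1 -> 0 < 1 + u ^+ 2 - 2 * u * cos t.
Proof.
move=> u0 ct; have {}ct : cos t < 1 by rewrite lt_neqAle ct cos_le1.
have [->|/eqP un0] := eqVneq u 0; first by lra.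
have up : 0 < u by rewrite lt_def u0 andbT; apply/eqP.
have ct' : 0 < 1 - cos t by rewrite subr_gt0.
by have := mulr_gt0 up ct'; have := sqr_ge0 (1 - u); nra.
Qed.

Lemma cos_lt1_pi t : 0 < t <= pi -> cos t < 1.
Proof.
move=> /andP[t0 tpi]; rewrite -cos0 ltr_cos// in_itv/= ?lexx ?pi_ge0//.
by rewrite ltW.
Qed.

Lemma cos_half t : cos t = 2 * cos (t / 2) ^+ 2 - 1.
Proof.
have {1}-> : t = (t / 2) *+ 2 by rewrite mulr2n; field.
by rewrite cos_mulr2n mulr2n; ring.
Qed.

(** Squared modulus of the second factor in [1 - u e^(it) = e^(it/2) ((1 - u) cos (t/2) - i (1 + u)
    sin (t/2))]. The same factorization is the origin of the arctangent in [circarg]. *)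
Lemma circ_half u t : 1 + u ^+ 2 - 2 * u * cos t =
  (1 + u) ^+ 2 * sin (t / 2) ^+ 2 + (1 - u) ^+ 2 * cos (t / 2) ^+ 2.
Proof.
by rewrite cos_half sin2cos2; ring.
Qed.

Lemma is_derive_lncirc c t x : 0 <= c -> 0 <= t -> cos x != 1 ->
  is_derive t 1 (fun t => lncirc (c * t) x)
    (c * (c * t - cos x) / (1 + (c * t) ^+ 2 - 2 * (c * t) * cos x)).
Proof.
move=> c0 t0 cx; have N0 := circ_gt0 (mulr_ge0 c0 t0) cx.
have dct := is_derive1M (is_derive1_cst c t) (is_derive1_idfun t).
have dN := is_derive1B (is_derive1D (is_derive1_cst 1 t) (is_derive1M dct dct))
  (is_derive1M (is_derive1M (is_derive1_cst 2 t) dct) (is_derive1_cst (cos x) t)).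
have dln := @is_derive1_comp _ (@ln R) (fun t => 1 + (c * t) ^+ 2 - 2 * (c * t) * cos x) _ _ _ (is_derive1_ln N0) dN.
apply: (is_derive1_eq (is_derive1M dln (is_derive1_cst 2^-1 t))).
by rewrite /=; field; rewrite gt_eqF.
Qed.

Lemma continuous_kernel_l c t x : 0 <= c -> 0 <= t -> cos x != 1 ->
  {for t, continuous (fun t => c * (c * t - cos x) / (1 + (c * t) ^+ 2 - 2 * (c * t) * cos x))}.
Proof.
move=> c0 t0 cx; have N0 := circ_gt0 (mulr_ge0 c0 t0) cx.
have cct : {for t, continuous (fun t => c * t)} by apply: cvgM; [exact: cvg_cst|exact: cvg_id].
apply: cvgM; first by apply: cvgM; [exact: cvg_cst|apply: cvgB => //; exact: cvg_cst].
apply: cvgV; first by rewrite gt_eqF.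
apply: cvgB; first by apply: cvgD; [exact: cvg_cst|exact: cvgM].
by apply: cvgM; [apply: cvgM => //; exact: cvg_cst|exact: cvg_cst].
Qed.

(** The Cauchy-Riemann equation of [log (1 - z)] in polar coordinates: the angular derivative of the
    argument is [u] times the radial derivative of [ln |1 - u e^(ix)|]. This is what links the two
    iterated integrals of [integral_circarg]. *)
Lemma is_derive_circarg u x : 0 <= u -> 0 < x <= pi ->
  is_derive x 1 (circarg u)
    (- (u * (u - cos x) / (1 + u ^+ 2 - 2 * u * cos x))).
Proof.
move=> u0 /andP[x0 xpi]; have cx : cos x != 1 by rewrite lt_eqF// cos_lt1_pi// x0.
have N0 := circ_gt0 u0 cx.
have s0 : 0 < sin (x / 2) by apply: sin_gt0_pi; apply/andP; split; lra.
have dh := is_derive1M (is_derive1_idfun x) (is_derive1_cst 2^-1 x).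
have dcos := @is_derive1_comp _ (@cos R) (fun x => x / 2) _ _ _ (is_derive_cos (x / 2)) dh.
have dsin := @is_derive1_comp _ (@sin R) (fun x => x / 2) _ _ _ (is_derive_sin (x / 2)) dh.
have dcot := is_derive1M dcos (is_derive1V (lt0r_neq0 s0) dsin).
have datan := @is_derive1_comp _ (@atan R)
  (fun x => (1 - u) / (1 + u) * (cos (x / 2) / sin (x / 2))) _ _ _ (is_derive1_atan _)
  (is_derive1M (is_derive1_cst ((1 - u) / (1 + u)) x) dcot).
have dl := is_derive1M (is_derive1B (is_derive1_cst pi x) (is_derive1_idfun x)) (is_derive1_cst 2^-1 x).
apply: (is_derive1_eq (is_derive1B dl datan)).
(* All terms are expressed by the sine and cosine of the half angle, with [C ^+ 2 = 1 - s ^+ 2], so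
   that a rational identity remains. *)
rewrite /= circ_half.
have := cos2Dsin2 (x / 2); rewrite circ_half in N0; move: N0 s0.
have -> : cos x = 1 - 2 * sin (x / 2) ^+ 2 by rewrite cos_half cos2sin2; ring.
set s := sin _; set C := cos _ => N0 s0 CS.
have C2 : C ^+ 2 = 1 - s ^+ 2 by rewrite -CS; ring.
rewrite C2 in N0 *.
have u1 : 1 + u != 0 by rewrite gt_eqF//; lra.
have sn0 : s != 0 by rewrite gt_eqF.
have -> : 1 + ((1 - u) / (1 + u) * (C / s)) ^+ 2 =
    ((1 + u) ^+ 2 * s ^+ 2 + (1 - u) ^+ 2 * (1 - s ^+ 2)) / ((1 + u) ^+ 2 * s ^+ 2).
  by rewrite -C2; field; rewrite u1 sn0.
have -> : - s * (1 / 2 + x * 0) / s + C * (- (C * (1 / 2 + x * 0)) / s ^+ 2) =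
    - (2 * s ^+ 2)^-1.
  transitivity (- (C ^+ 2 + s ^+ 2) / (2 * s ^+ 2)); first by field.
  by rewrite CS mulN1r.
by field; rewrite exprMn u1 sn0 gt_eqF.
Qed.

Lemma continuous_kernel_r u x : 0 <= u -> cos x != 1 ->
  {for x, continuous (fun x => u * (u - cos x) / (1 + u ^+ 2 - 2 * u * cos x))}.
Proof.
move=> u0 cx; have N0 := circ_gt0 u0 cx.
apply: cvgM; first by apply: cvgM; [exact: cvg_cst|apply: cvgB; [exact: cvg_cst|exact: continuous_cos]].
apply: cvgV; first by rewrite gt_eqF.
apply: cvgB; first exact: cvg_cst.
by apply: cvgM; [exact: cvg_cst|exact: continuous_cos].
Qed.

Lemma circarg_pi u : circarg u pi = 0.
Proof. by rewrite /circarg subrr mul0r cos_pihalf mul0r mulr0 atan0 subrr. Qed.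

Lemma atan_cot t : 0 < t < pi -> atan (cos t / sin t) = pi / 2 - t.
Proof.
move=> /andP[t0 tpi]; rewrite -[RHS]tanK; last by rewrite in_itv/=; apply/andP; split; lra.
by rewrite /tan -[pi / 2 - t]opprB cosN sinN sinBpihalf cosBpihalf opprK.
Qed.

(** [k = (1 - u) / (1 + u)] lies in [[-1, 1]] and the arctangent of [cot (phi / 2)] is
    [(pi - phi) / 2], so [atan (k cot (phi / 2))] is at most that in absolute value. The range
    [[0, pi]] is the one on which [acos] inverts [cos]. *)
Lemma circarg_bounds u phi : 0 <= u -> 0 < phi < pi -> 0 <= circarg u phi <= pi.
Proof.
move=> u0 /andP[p0 ppi].
have s0 : 0 < sin (phi / 2) by apply: sin_gt0_pi; apply/andP; split; lra.
have c0 : 0 < cos (phi / 2) by apply: cos_gt0_pihalf; apply/andP; split; lra.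
have cot : atan (cos (phi / 2) / sin (phi / 2)) = (pi - phi) / 2.
  by rewrite atan_cot; [field|apply/andP; split; lra].
have ct0 : 0 <= cos (phi / 2) / sin (phi / 2) by rewrite divr_ge0// ltW.
have u1 : 0 < 1 + u by lra.
have k1 : (1 - u) / (1 + u) <= 1 by rewrite ler_pdivrMr// mul1r; lra.
have kN1 : -1 <= (1 - u) / (1 + u) by rewrite ler_pdivlMr//; lra.
rewrite /circarg; set k := (1 - u) / (1 + u) in k1 kN1 *.
have h1 : atan (k * (cos (phi / 2) / sin (phi / 2))) <= (pi - phi) / 2.
  by rewrite -cot; apply: le_atan; rewrite ler_piMl.
have h2 : - ((pi - phi) / 2) <= atan (k * (cos (phi / 2) / sin (phi / 2))).
  by rewrite -cot -atanN; apply: le_atan; rewrite -mulN1r ler_wpM2r.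
by apply/andP; split; lra.
Qed.

(** Real part over modulus of [1 - u e^(i phi)]: the argument of [acos] in the definition of
    [carg]. *)
Lemma cos_circarg u phi : 0 <= u -> 0 < phi < pi ->
  cos (circarg u phi) = (1 - u * cos phi) / Num.sqrt (1 + u ^+ 2 - 2 * u * cos phi).
Proof.
move=> u0 /andP[p0 ppi].
have s0 : 0 < sin (phi / 2) by apply: sin_gt0_pi; apply/andP; split; lra.
have u1 : 0 < 1 + u by lra.
have N0 : 0 < 1 + u ^+ 2 - 2 * u * cos phi.
  by rewrite circ_gt0// lt_eqF// cos_lt1_pi// p0 ltW.
have sat y : sin (atan y) = y / Num.sqrt (1 + y ^+ 2).
  rewrite -cos_atan -{2}(atanK y) /tan mulfVK// cos_atan invr_eq0 sqrtr_eq0 -ltNge.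
  by have := sqr_ge0 y; lra.
rewrite /circarg cosB cos_atan sat.
have -> : (pi - phi) / 2 = - (phi / 2 - pi / 2) by field.
rewrite cosN sinN cosBpihalf sinBpihalf opprK.
set y := _ / _ * _.
have -> : Num.sqrt (1 + y ^+ 2) =
    Num.sqrt (1 + u ^+ 2 - 2 * u * cos phi) / ((1 + u) * sin (phi / 2)).
  have -> : 1 + y ^+ 2 = (1 + u ^+ 2 - 2 * u * cos phi) / ((1 + u) * sin (phi / 2)) ^+ 2.
    by rewrite circ_half /y; field; rewrite !gt_eqF.
  by rewrite sqrtrM ?(ltW N0)// sqrtrV ?sqr_ge0// sqrtr_sqr ger0_norm// mulr_ge0// ltW.
have M0 : Num.sqrt (1 + u ^+ 2 - 2 * u * cos phi) != 0 by rewrite sqrtr_eq0 -ltNge.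
set M := Num.sqrt _ in M0 *.
have -> : cos phi = cos (phi / 2) ^+ 2 - sin (phi / 2) ^+ 2.
  by rewrite cos_half sin2cos2; ring.
rewrite -[X in _ = (X - _) / _](cos2Dsin2 (phi / 2)) /y.
by field; rewrite M0 !gt_eqF.
Qed.

Lemma cmodE (z : R[i]) : cmod z = Num.sqrt (complex.Re z ^+ 2 + complex.Im z ^+ 2).
Proof. by case: z. Qed.

Lemma ReImM (z w : R[i]) :
  complex.Re (z * w) = complex.Re z * complex.Re w - complex.Im z * complex.Im w /\
  complex.Im (z * w) = complex.Re z * complex.Im w + complex.Im z * complex.Re w.
Proof. by case: z => a b; case: w => c d. Qed.

Lemma Re_oneBpolar u phi : complex.Re (1 - u%:C * cexpi phi) = 1 - u * cos phi.
Proof. by rewrite /= mul0r subr0. Qed.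

Lemma Im_oneBpolar u phi : complex.Im (1 - u%:C * cexpi phi) = - (u * sin phi).
Proof. by rewrite /= mul0r addr0 sub0r. Qed.

Lemma cmod_oneBpolar u phi :
  cmod (1 - u%:C * cexpi phi) = Num.sqrt (1 + u ^+ 2 - 2 * u * cos phi).
Proof.
rewrite cmodE Re_oneBpolar Im_oneBpolar; congr Num.sqrt.
by rewrite sqrrN !exprMn sin2cos2; ring.
Qed.

(** The imaginary part [- u sin phi] is negative, so [carg] takes its second branch, whence the
    sign. *)
Lemma carg_oneBpolar u phi : 0 < u -> 0 < phi < pi ->
  carg (1 - u%:C * cexpi phi) = - circarg u phi.
Proof.
move=> u0 hphi; have sp : 0 < sin phi by exact: sin_gt0_pi.
rewrite /carg Im_oneBpolar Re_oneBpolar cmod_oneBpolar oppr_ge0 leNgt mulr_gt0//=.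
by rewrite -cos_circarg ?(ltW u0)// cosK// in_itv/= circarg_bounds// ltW.
Qed.

(* At [t = 0] both sides are [0] because of division by zero. *)
Lemma Im_Li2_integrand c t phi : 0 < c -> 0 < phi < pi -> 0 <= t ->
  complex.Im (clog (1 - t%:C * (c%:C * cexpi phi)) / (t%:C * (c%:C * cexpi phi)) *
    (c%:C * cexpi phi)) = - (circarg (c * t) phi / t).
Proof.
move=> c0 hphi; set z := c%:C * cexpi phi.
rewrite le_eqVlt => /predU1P[<-|t0]; first by rewrite rmorph0 !mul0r invr0 !(mulr0, mul0r) invr0 mulr0 oppr0.
have z0 : z != 0.
  rewrite mulf_eq0 negb_or; apply/andP; split; first by rewrite fmorph_eq0 gt_eqF.
  apply/negP => /eqP[_ s0]; have := sin_gt0_pi hphi.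
  by rewrite s0 ltxx.
have -> : clog (1 - t%:C * z) / (t%:C * z) * z = (t^-1)%:C * clog (1 - t%:C * z).
  have t0C : t%:C != 0 :> R[i] by rewrite fmorph_eq0 gt_eqF.
  by rewrite fmorphV; field; rewrite t0C z0.
have [_ ->] := ReImM (t^-1)%:C (clog (1 - t%:C * z)).
rewrite /= mul0r addr0 /z mulrA -rmorphM/= carg_oneBpolar ?mulr_gt0//.
by rewrite mulrN mulrC [t * c]mulrC.
Qed.

End Dilogarithm.

(** * The Bloch-Wigner function on the upper half-plane as an arc integral *)

Section DilogarithmIntegral.
Context {R : realType}.
Local Notation mu := (@lebesgue_measure R).
Implicit Types (c u t phi : R).

(** Uses [1 / f = f * (f ^+ 2)^-1] with the inverse written as a real power of a nonnegative number;
    at the zeros of [f] both sides are [0]. *)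
Lemma measurable_funV d (T : measurableType d) (f : T -> R) (D : set T) :
  measurable_fun D f -> measurable_fun D (fun x => (f x)^-1).
Proof.
move=> mf; rewrite [X in measurable_fun _ X](_ : _ =
    (fun x => f x * powR (f x ^+ 2) (-1))); last first.
  apply/funext => x; rewrite powR_inv1 ?sqr_ge0//.
  have [->|fx0] := eqVneq (f x) 0; first by rewrite invr0 mul0r.
  by field.
apply: measurable_funM => //.
by apply: (measurableT_comp (measurable_powR (-1))); exact: measurable_funX.
Qed.

Let kernel c (w : R * R) : R :=
  c * (c * w.2 - cos w.1) / (1 + (c * w.2) ^+ 2 - 2 * (c * w.2) * cos w.1).

Let measurable_kernel c : measurable_fun setT (kernel c).
Proof.
have mc : measurable_fun setT (fun w : R * R => cos w.1).
  by apply: (measurableT_comp measurable_cos); exact: measurable_fst.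
have mt : measurable_fun setT (fun w : R * R => c * w.2).
  by apply: measurable_funM => //; exact: measurable_snd.
apply: measurable_funM; first by apply: measurable_funM => //; exact: measurable_funB.
apply: measurable_funV; apply: measurable_funB; last first.
  by apply: measurable_funM => //; exact: measurable_funM.
by apply: measurable_funD => //; exact: measurable_funX.
Qed.

(** For [th >= phi] the denominator is at least [1 + (c t)^2 - 2 c t cos phi = (c t - cos phi)^2 +
    sin^2 phi >= sin^2 phi], and the numerator is at most [c (c + 1)] in absolute value. Their
    quotient is [C]. *)
Let integrable_kernel c phi : 0 < c -> 0 < phi < pi ->
  (mu \x mu)%E.-integrable (`[phi, pi] `*` `[0, 1]) (EFin \o kernel c).
Proof.
move=> c0 /andP[p0 ppi]; apply: measurable_bounded_integrable.
- exact: measurableX.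
- rewrite [X in (X < _)%E](@product_measure1E _ _ _ _ R mu mu `[phi, pi] `[0, 1])//= !lebesgue_measure_itv/= !lte_fin ltr01 ppi.
  by rewrite -!EFinB -EFinM ltey.
- apply: measurable_funTS. exact: measurable_kernel.
pose C := c * (c + 1) / sin phi ^+ 2.
exists C; split; first exact: num_real.
move=> M CM [th t] /= [/[!in_itv]/= /andP[th0 th1] /andP[t0 t1]].
apply: le_trans (ltW CM); rewrite /kernel /C /=.
have sp : 0 < sin phi by rewrite sin_gt0_pi// p0.
have cth : cos th <= cos phi.
  rewrite leNgt ltr_cos ?in_itv/= -?leNgt//; apply/andP; split; lra.
have N0 : sin phi ^+ 2 <= 1 + (c * t) ^+ 2 - 2 * (c * t) * cos th.
  have ct0 : 0 <= c * t by rewrite mulr_ge0// ltW.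
  rewrite sin2cos2; have := sqr_ge0 (c * t - cos phi).
  have : 0 <= (c * t) * (cos phi - cos th) by rewrite mulr_ge0// subr_ge0.
  by nra.
have N1 : 0 < sin phi ^+ 2 by rewrite exprn_gt0.
rewrite normrM normfV [`|1 + _ - _|]ger0_norm ?(le_trans (ltW N1))//.
apply: ler_pM => //; first by rewrite invr_ge0 (le_trans (ltW N1)).
  rewrite normrM [`|c|]gtr0_norm// ler_pM2l// (le_trans (ler_normB _ _))// lerD ?cos_max//.
  by rewrite normrM [`|c|]gtr0_norm// [`|t|]ger0_norm// ler_piMr// ltW.
by rewrite lef_pV2// posrE (lt_le_trans N1).
Qed.

Lemma measurable_circarg c phi : measurable_fun setT (fun t => circarg (c * t) phi / t).
Proof.
apply: measurable_funM; last exact: measurable_funV.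
apply: measurable_funB => //.
apply: (measurableT_comp (continuous_measurable_fun (@continuous_atan R))).
apply: measurable_funM => //; apply: measurable_funM.
  by apply: measurable_funB => //; exact: measurable_funM.
by apply: measurable_funV; apply: measurable_funD => //; exact: measurable_funM.
Qed.

(* Both sides are the integral over [phi <= th <= pi], [0 <= t <= 1] of
   [d/dt ln |1 - c t e^(i th)|]. *)
Lemma integral_circarg c phi : 0 < c -> 0 < phi < pi ->
  (\int[mu]_(t in `[0%R, 1%R]) (circarg (c * t) phi / t)%:E =
   \int[mu]_(th in `[phi, pi]) (lncirc c th)%:E)%E.
Proof.
move=> c0 hphi; have [p0 ppi] := andP hphi.
transitivity (\int[mu]_(th in `[phi, pi]) \int[mu]_(t in `[0%R, 1%R]) (kernel c (th, t))%:E)%E; last first.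
  apply: eq_integral => th; rewrite inE/= in_itv/= => /andP[th0 th1].
  have cth : cos th != 1 by rewrite lt_eqF// cos_lt1_pi// th1 (lt_le_trans p0).
  rewrite (@continuous_FTC2_closed _ (fun t => lncirc (c * t) th))//.
  - rewrite mulr1 mulr0 {2}/lncirc expr0n/= addr0 mulr0 mul0r subr0 ln1 mul0r subr0//.
  - by move=> t; rewrite in_itv/= => /andP[t0 _]; apply: is_derive_lncirc => //; exact: ltW.
  - by move=> t; rewrite in_itv/= => /andP[t0 _]; apply: continuous_kernel_l => //; exact: ltW.
rewrite (integral_rect_swap _ _ (integrable_kernel c0 hphi))//.
(* The point [t = 0] must be left out: there the right side is [0] by division by zero, while the
   integral of the kernel is [c sin phi]. The endpoint is removed from both outer integrals
   below. *)
have E t : t \in `]0, 1]%classic ->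
    (\int[mu]_(th in `[phi, pi]) (kernel c (th, t))%:E = (circarg (c * t) phi / t)%:E)%E.
  rewrite inE/= in_itv/= => /andP[t0 _]; have ct0 : 0 <= c * t by rewrite mulr_ge0// ltW.
  rewrite (@continuous_FTC2_closed _ (fun th => - (circarg (c * t) th) / t) (fun th => kernel c (th, t)) phi pi ppi).
  - by rewrite circarg_pi oppr0 mul0r sub0r mulNr opprK.
  - move=> th; rewrite in_itv/= => /andP[th0 th1].
    have hth : 0 < th <= pi by rewrite th1 andbT (lt_le_trans p0).
    have dM := is_derive1M (is_derive1N (is_derive_circarg ct0 hth)) (is_derive1_cst t^-1 th).
    refine (is_derive1_eq dM _).
    rewrite /kernel/= opprK mulr0 addr0; field.
    by rewrite (gt_eqF t0) gt_eqF// circ_gt0// lt_eqF// cos_lt1_pi.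
  - move=> th; rewrite in_itv/= => /andP[th0 th1].
    have cth : cos th != 1 by rewrite lt_eqF// cos_lt1_pi// th1 (lt_le_trans p0).
    have -> : (fun th => kernel c (th, t)) = (fun th => t^-1 *
        (c * t * (c * t - cos th) / (1 + (c * t) ^+ 2 - 2 * (c * t) * cos th))).
      apply/funext => x; rewrite /kernel/= !mulrA; congr (_ * _ / _).
      by rewrite mulrC mulrA divff ?mul1r// gt_eqF.
    by apply: cvgM; [exact: cvg_cst|exact: continuous_kernel_r].
have mg := @measurable_circarg c phi.
rewrite -(@integral_itv_obnd_cbnd _ 0 (BRight 1)); last first.
  by apply/measurable_EFinP; exact: measurable_funTS.
rewrite -(@integral_itv_obnd_cbnd _ 0 (BRight 1)); last first.
  apply: (eq_measurable_fun (fun t => (circarg (c * t) phi / t)%:E)).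
    by move=> t t01; rewrite E.
  by apply/measurable_EFinP; exact: measurable_funTS.
by apply: eq_integral => t t01; rewrite E.
Qed.

(** Covers [c = 1]: the singularity is at the angle [0], off the arc, and [sin phi ^+ 2] is again a
    lower bound for the squared modulus. *)
Lemma integrable_lncirc_arc c phi : 0 < c -> 0 < phi < pi ->
  mu.-integrable `[phi, pi] (EFin \o lncirc c).
Proof.
move=> c0 /andP[p0 ppi].
have sp : 0 < sin phi by rewrite sin_gt0_pi// p0.
apply: integrable_itv_bounded; first exact: measurable_lncirc.
move=> th; rewrite in_itv/= => /andP[th0 th1].
apply: (lncirc_bound_gen (ltW c0) (exprn_gt0 2 sp)).
have cth : cos th <= cos phi.
  rewrite leNgt ltr_cos ?in_itv/= -?leNgt//; apply/andP; split; lra.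
rewrite sin2cos2; have := sqr_ge0 (c - cos phi).
have : 0 <= c * (cos phi - cos th) by rewrite mulr_ge0 ?subr_ge0// ltW.
by nra.
Qed.

Lemma Im_Li2 c phi : 0 < c -> 0 < phi < pi ->
  complex.Im (Li2 (c%:C * cexpi phi)) = \int[mu]_(th in `[phi, pi]) lncirc c th.
Proof.
move=> c0 hphi; rewrite /Li2 /cintegral.
set A := Rintegral _ _ _; set B := Rintegral _ _ _.
have -> : complex.Im (- (A +i* B)) = - B by [].
rewrite /B /Rintegral -integral_circarg//.
(* Nonnegativity of [circarg] lets the sign leave the integral, where it cancels the one in the
   definition of [Li2]. *)
rewrite [X in - fine X](_ : _ = \int[mu]_(t in `[0%R, 1%R]) - (circarg (c * t) phi / t)%:E)%E.
  rewrite integral_ge0N ?fineN ?opprK//= => t; rewrite in_itv/= => /andP[t0 _].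
  have ct0 : 0 <= c * t by rewrite mulr_ge0// ltW.
  by rewrite lee_fin divr_ge0//; have /andP[] := circarg_bounds ct0 hphi.
apply: eq_integral => t t01; rewrite Im_Li2_integrand//.
by move: t01; rewrite inE/= in_itv/= => /andP[].
Qed.

Lemma BlochWigner_polar c phi : 0 < c -> 0 < phi < pi ->
  BlochWigner (c%:C * cexpi phi) =
  \int[mu]_(th in `[phi, pi]) lncirc c th - circarg c phi * ln c.
Proof.
move=> c0 hphi; rewrite /BlochWigner Im_Li2// carg_oneBpolar// mulNr.
congr (_ - _ * ln _); rewrite cmodE /= !mul0r subr0 addr0 !exprMn -mulrDr.
by rewrite cos2Dsin2 mulr1 sqrtr_sqr gtr0_norm.
Qed.

End DilogarithmIntegral.

(** * Moduli and polar form of complex numbers *)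

Section ComplexModulus.
Context {R : realType}.
Implicit Types (x y t : R) (z w P Q : R[i]).

Lemma cmodM z w : cmod (z * w) = cmod z * cmod w.
Proof. exact: ComplexField.Normc.normcM. Qed.

Lemma cmodV z : cmod z^-1 = (cmod z)^-1.
Proof. exact: ComplexField.Normc.normcV. Qed.

Lemma cmodN z : cmod (- z) = cmod z.
Proof. exact: normcN. Qed.

Lemma cmodD_le z w : cmod (z + w) <= cmod z + cmod w.
Proof. exact: le_normcD. Qed.

Lemma cmod_ge0 z : 0 <= cmod z.
Proof. by rewrite cmodE sqrtr_ge0. Qed.

Lemma cmod_eq0 z : (cmod z == 0) = (z == 0).
Proof.
apply/eqP/eqP => [/ComplexField.Normc.eq0_normc//|->].
exact: ComplexField.Normc.normc0.
Qed.

Lemma cmod_gt0 z : (0 < cmod z) = (z != 0).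
Proof. by rewrite lt_def cmod_eq0 cmod_ge0 andbT. Qed.

Lemma cmod_real x : 0 <= x -> cmod x%:C = x.
Proof. by move=> x0; rewrite cmodE /= expr0n/= addr0 sqrtr_sqr ger0_norm. Qed.

Lemma cmod_i : cmod ('i : R[i]) = 1.
Proof. by rewrite cmodE /= expr0n/= add0r expr1n sqrtr1. Qed.

Lemma cmod_cexpi t : cmod (cexpi t : R[i]) = 1.
Proof. by rewrite cmodE /= cos2Dsin2 sqrtr1. Qed.

Lemma cexpi_neq0 t : cexpi t != 0 :> R[i].
Proof. by rewrite -cmod_gt0 cmod_cexpi. Qed.

Lemma cexpiD x y : cexpi (x + y) = cexpi x * cexpi y :> R[i].
Proof. by rewrite /cexpi cosD sinD; apply/eqP; rewrite eq_complex/= eqxx/= addrC. Qed.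

Lemma cexpi0 : cexpi 0 = 1 :> R[i].
Proof. by rewrite /cexpi cos0 sin0. Qed.

Lemma cexpiN x : cexpi (- x) = (cexpi x)^-1 :> R[i].
Proof.
apply: (mulfI (cexpi_neq0 x)); rewrite -cexpiD subrr cexpi0 mulfV//.
exact: cexpi_neq0.
Qed.

Lemma cexpi_pi : cexpi pi = -1 :> R[i].
Proof. by rewrite /cexpi cospi sinpi; apply/eqP; rewrite eq_complex/= oppr0 !eqxx. Qed.

Lemma cexpi_pihalf : cexpi (pi / 2) = 'i :> R[i].
Proof. by rewrite /cexpi cos_pihalf sin_pihalf. Qed.

Lemma cexpi_2pi : cexpi (2 * pi) = 1 :> R[i].
Proof. by rewrite mulr_natl mulr2n cexpiD cexpi_pi mulrNN mulr1. Qed.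

Lemma cexpi_periodic x : cexpi (x + 2 * pi) = cexpi x :> R[i].
Proof. by rewrite cexpiD cexpi_2pi mulr1. Qed.

Lemma lncircE rho t : ln (cmod (1 - rho%:C * cexpi t)) = lncirc rho t.
Proof.
rewrite cmod_oneBpolar /lncirc; set v := 1 + _ - _.
have v0 : 0 <= v.
  by rewrite /v; have := sqr_ge0 (rho - cos t); have := cos2Dsin2 t; have := sqr_ge0 (sin t); nra.
(* Where the modulus vanishes both sides are [0], since [ln 0 = 0]. *)
have [v00|vn0] := eqVneq v 0; first by rewrite v00 sqrtr0 ln0// mul0r.
rewrite -{2}(sqr_sqrtr v0) lnXn ?sqrtr_gt0 ?lt_def ?vn0//.
by rewrite mulr2n; field.
Qed.

(** The angle is taken in one period so that it is an admissible shift in [integral_periodic_shift];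
    a point below the real axis gets [2 * pi - acos]. *)
Lemma polar_form z : exists2 psi, 0 <= psi <= 2 * pi & z = (cmod z)%:C * cexpi psi.
Proof.
have pi0 := @pi_gt0 R.
have [->|z0] := eqVneq z 0.
  by exists 0; rewrite ?lexx ?mulr_ge0 ?pi_ge0// (_ : cmod 0 = 0) ?mul0r//; apply/eqP; rewrite cmod_eq0.
have r0 : 0 < cmod z by rewrite cmod_gt0.
set r := cmod z in r0 *.
have rE : complex.Re z ^+ 2 + complex.Im z ^+ 2 = r ^+ 2.
  by rewrite /r cmodE sqr_sqrtr// addr_ge0// sqr_ge0.
pose x := complex.Re z / r.
have xy : x ^+ 2 + (complex.Im z / r) ^+ 2 = 1.
  by rewrite /x !exprMn -mulrDl rE -exprMn divff ?expr1n// gt_eqF.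
have x1 : -1 <= x <= 1.
  by have := sqr_ge0 (complex.Im z / r); move=> h; apply/andP; split; nra.
have sx : sin (acos x) = `|complex.Im z / r|.
  by rewrite sin_acos// -xy addrAC subrr add0r sqrtr_sqr.
have xr : r * x = complex.Re z by rewrite /x mulrC divfK// gt_eqF.
have yr : r * (complex.Im z / r) = complex.Im z by rewrite mulrC divfK// gt_eqF.
have a0 := acos_ge0 x1; have api := acos_lepi x1.
have [y0|y0] := leP 0 (complex.Im z).
- exists (acos x); first by rewrite a0/=; lra.
  apply/eqP; rewrite eq_complex/= !mul0r subr0 addr0 acosK// xr sx ger0_norm.
    by rewrite yr !eqxx.
  by rewrite divr_ge0// ltW.
- exists (- acos x + 2 * pi); first by apply/andP; split; lra.
  rewrite cexpi_periodic.
  apply/eqP; rewrite eq_complex/= !mul0r subr0 addr0 cosN sinN acosK// xr sx ltr0_norm.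
    by rewrite opprK yr !eqxx.
  by rewrite pmulr_llt0// invr_gt0.
Qed.

End ComplexModulus.

(** * Measurability of complex-valued functions by components *)

Section ComplexMeasurable.
Context {R : realType} {d : measure_display} {T : measurableType d}.
Implicit Types (f g : T -> R[i]).

Definition cmeasurable f :=
  measurable_fun setT (fun x => complex.Re (f x)) /\
  measurable_fun setT (fun x => complex.Im (f x)).

Lemma cmeasurable_cst z : cmeasurable (fun=> z).
Proof. by split; exact: measurable_cst. Qed.

Lemma cmeasurable_cexpi (s : T -> R) : measurable_fun setT s ->
  cmeasurable (fun x => cexpi (s x)).
Proof.
move=> ms; split; first exact: (measurableT_comp measurable_cos).
exact: (measurableT_comp measurable_sin).
Qed.

Lemma cmeasurableD f g : cmeasurable f -> cmeasurable g -> cmeasurable (fun x => f x + g x).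
Proof.
move=> [f1 f2] [g1 g2]; split.
- rewrite [X in measurable_fun _ X](_ : _ = fun x => complex.Re (f x) + complex.Re (g x)).
    exact: measurable_funD.
  by apply/funext => x; case: (f x); case: (g x).
- rewrite [X in measurable_fun _ X](_ : _ = fun x => complex.Im (f x) + complex.Im (g x)).
    exact: measurable_funD.
  by apply/funext => x; case: (f x); case: (g x).
Qed.

Lemma cmeasurableM f g : cmeasurable f -> cmeasurable g -> cmeasurable (fun x => f x * g x).
Proof.
move=> [f1 f2] [g1 g2]; split.
- rewrite [X in measurable_fun _ X](_ : _ = fun x =>
      complex.Re (f x) * complex.Re (g x) - complex.Im (f x) * complex.Im (g x)).
    by apply: measurable_funB; exact: measurable_funM.
  by apply/funext => x; rewrite (ReImM (f x) (g x)).1.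
- rewrite [X in measurable_fun _ X](_ : _ = fun x =>
      complex.Re (f x) * complex.Im (g x) + complex.Im (f x) * complex.Re (g x)).
    by apply: measurable_funD; exact: measurable_funM.
  by apply/funext => x; rewrite (ReImM (f x) (g x)).2.
Qed.

Lemma cmeasurableN f : cmeasurable f -> cmeasurable (fun x => - f x).
Proof.
move=> mf; rewrite (_ : (fun _ => _) = fun x => -1 * f x).
  by apply: cmeasurableM => //; exact: cmeasurable_cst.
by apply/funext => x; rewrite mulN1r.
Qed.

Lemma cmeasurableV f : cmeasurable f -> cmeasurable (fun x => (f x)^-1).
Proof.
move=> [f1 f2].
have mN : measurable_fun setT (fun x => complex.Re (f x) ^+ 2 + complex.Im (f x) ^+ 2).
  by apply: measurable_funD; exact: measurable_funX.
split.
- rewrite [X in measurable_fun _ X](_ : _ = fun x =>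
      complex.Re (f x) / (complex.Re (f x) ^+ 2 + complex.Im (f x) ^+ 2)).
    by apply: measurable_funM => //; exact: measurable_funV.
  by apply/funext => x; case: (f x).
- rewrite [X in measurable_fun _ X](_ : _ = fun x =>
      - complex.Im (f x) / (complex.Re (f x) ^+ 2 + complex.Im (f x) ^+ 2)).
    by apply: measurable_funM; [exact: measurable_funN|exact: measurable_funV].
  by apply/funext => x; case: (f x) => u v /=; rewrite mulNr.
Qed.

Lemma measurable_cmod f : cmeasurable f -> measurable_fun setT (fun x => cmod (f x)).
Proof.
move=> [f1 f2]; rewrite [X in measurable_fun _ X](_ : _ = fun x =>
    Num.sqrt (complex.Re (f x) ^+ 2 + complex.Im (f x) ^+ 2)).
  apply: (measurableT_comp (continuous_measurable_fun (@sqrt_continuous R))).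
  by apply: measurable_funD; exact: measurable_funX.
by apply/funext => x; rewrite cmodE.
Qed.

End ComplexMeasurable.

(** * The nonnegative substitute for the logarithm *)

Section Gap.
Context {R : realType}.
Local Notation mu := (@lebesgue_measure R).
Implicit Types (K v : R).
Local Open Scope ereal_scope.

(* Nonnegative for [v <= K], so that Tonelli's theorem applies to [ln]
   in spite of its singularity at [0]. *)
Definition gap K v : \bar R := (ln K)%:E - lne v%:E.

Lemma gap_ge0 K v : (0 < K)%R -> (0 <= v <= K)%R -> 0 <= gap K v.
Proof.
move=> K0 /andP[v0 vK]; rewrite /gap; move: v0; rewrite le_eqVlt => /predU1P[<-|v0].
  by rewrite le0_lneNy//= leey.
by rewrite lne_EFin// -EFinB lee_fin subr_ge0 ler_ln.
Qed.

Lemma gap_EFin K v : (0 < v)%R -> gap K v = (ln K - ln v)%:E.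
Proof. by move=> v0; rewrite /gap lne_EFin. Qed.

(** Also valid where [lne] is infinite: [gap] is then the opposite infinity and absorbs the finite
    [ln K]. This returns to the logarithm once the integral of [gap] is known. *)
Lemma lneE_gap K v : lne v%:E = (ln K)%:E - gap K v.
Proof.
rewrite /gap; case: (lne v%:E) => [r| |] //=.
by rewrite -!EFinB; congr EFin; ring.
Qed.

Lemma gapM K1 K2 v1 v2 : (0 < K1)%R -> (0 < K2)%R -> (0 <= v1)%R -> (0 <= v2)%R ->
  gap (K1 * K2) (v1 * v2) = gap K1 v1 + gap K2 v2.
Proof.
move=> K10 K20; have gap0 K : gap K 0 = +oo by rewrite /gap le0_lneNy.
rewrite le_eqVlt => /predU1P[<-|v10].
  rewrite mul0r !gap0 le_eqVlt => /predU1P[<-|v20]; first by rewrite gap0.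
  by rewrite gap_EFin.
rewrite le_eqVlt => /predU1P[<-|v20].
  by rewrite mulr0 !gap0 gap_EFin.
by rewrite !gap_EFin ?mulr_gt0// !lnM ?posrE// -EFinD; congr EFin; ring.
Qed.

Lemma measurable_gap d (T : measurableType d) K (f : T -> R) : measurable_fun setT f ->
  measurable_fun setT (fun x => gap K (f x)).
Proof.
move=> mf; rewrite (_ : (fun _ => _) =
    fun x => if (f x <= 0)%R then +oo else (ln K - ln (f x))%:E); last first.
  by apply/funext => x; rewrite /gap/=; case: ifPn.
apply: measurable_fun_ifT.
- exact: measurable_fun_ler.
- exact: measurable_cst.
- apply/measurable_EFinP; apply: measurable_funB => //.
  exact: (measurableT_comp (@measurable_ln R)).
Qed.

End Gap.

(** * Reduction of the torus integral to an integral over one circle *)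

Section Reduction.
Context {R : realType}.
Local Notation mu := (@lebesgue_measure R).
Local Notation I := (`[0%R, (2 * pi)%R]%classic : set R).
Implicit Types (c d s t K : R) (P Q : R[i]).

(** With [- Q / P = rho e^(i psi)] one has [|P + Q e^(it)| = |P| |1 - rho e^(i (t + psi))|], and the
    shift by [psi] disappears over a period. Distinct moduli mean [rho <> 1], so the logarithm stays
    finite on the circle. *)
Lemma integral_gap_affine K P Q : P != 0 -> Q != 0 -> cmod P != cmod Q ->
  (\int[mu]_(t in I) gap K (cmod (P + Q * cexpi t)%R) =
   (2 * pi * (ln K - Num.max (ln (cmod P)) (ln (cmod Q))))%:E)%E.
Proof.
move=> P0 Q0 PQ; have [psi hpsi QP] := polar_form (- Q / P).
have cP : 0 < cmod P by rewrite cmod_gt0.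
have cQ : 0 < cmod Q by rewrite cmod_gt0.
set rho := cmod (- Q / P) in QP.
have rhoE : rho = cmod Q / cmod P by rewrite /rho cmodM cmodN cmodV.
have rho0 : 0 < rho by rewrite rhoE divr_gt0.
have rho1 : rho != 1.
  apply: contra PQ => /eqP r1; apply/eqP; move: r1; rewrite rhoE => /(congr1 ( *%R^~ (cmod P))).
  by rewrite divfK ?gt_eqF// mul1r.
have E t : cmod (P + Q * cexpi t) = cmod P * cmod (1 - rho%:C * cexpi (t + psi)).
  rewrite -cmodM; congr cmod; rewrite cexpiD [cexpi t * _]mulrC mulrA -QP.
  by field.
have g t : gap K (cmod (P + Q * cexpi t)) = (ln K - ln (cmod P) - lncirc rho (t + psi))%:E.
  have v0 : 0 < cmod (1 - rho%:C * cexpi (t + psi)).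
    rewrite cmod_oneBpolar sqrtr_gt0; apply: lt_le_trans (circ_ge _ (ltW rho0)).
    by rewrite exprn_even_gt0//= subr_eq0 eq_sym.
  rewrite E gap_EFin ?mulr_gt0// lnM ?posrE// lncircE.
  by congr EFin; ring.
under eq_integral do rewrite g.
rewrite (@integral_periodic_shift _ (2 * pi) psi
  (fun t => (ln K - ln (cmod P) - lncirc rho t)%:E))//; last 2 first.
- by apply/measurable_EFinP; apply: measurable_funB => //; exact: measurable_lncirc.
- by move=> t; have -> : lncirc rho (t + 2 * pi) = lncirc rho t; rewrite // /lncirc [2 * pi]mulr_natl cosD2pi.
have Ic : mu.-integrable I (EFin \o (fun=> ln K - ln (cmod P))).
  by apply: (@integrable_itv_bounded _ _ _ `|ln K - ln (cmod P)|).
have Il := integrable_lncirc 0 (2 * pi) (ltW rho0) rho1.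
rewrite EFin_Rintegral; last first.
  by apply: (@integrableB _ _ R mu I _ (EFin \o (fun=> ln K - ln (cmod P))) (EFin \o lncirc rho)).
rewrite RintegralB// Rintegral_lncirc// Rintegral_cst//= lebesgue_measure_itv/= lte_fin.
rewrite ifT; last by have := @pi_gt0 R; lra.
rewrite sube0/= (_ : ln (cmod Q) = ln (cmod P) + ln rho); last first.
  by rewrite rhoE ln_div ?posrE//; ring.
congr EFin; rewrite -{2}[ln (cmod P)]addr0 -addr_maxr.
by ring.
Qed.

Lemma negligible_cos_eq (k : R) : mu.-negligible (I `&` [set s | cos s = k]).
Proof.
have N x : mu.-negligible [set x] by apply/negligibleP => //; exact: lebesgue_measure_set1.
apply: negligibleS (negligibleU (N (acos k)) (N (2 * pi - acos k))) => s [/=]; rewrite in_itv/= => /andP[s0 s2] <-.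
have [spi|spi] := leP s pi.
  by left; rewrite cosK// in_itv/= s0.
right; have -> : cos s = cos (2 * pi - s).
  by rewrite cosB mulr_natl cos2pi sin2pi; ring.
rewrite cosK; first by ring.
by rewrite in_itv/=; apply/andP; split; lra.
Qed.

(** With [i] a variable, the expansion of the product is a polynomial identity; [i ^+ 2 = -1] enters
    only afterwards. *)
Lemma factor_identity (F : fieldType) (i w z : F) : i ^+ 2 = -1 -> w != 0 -> z != 0 ->
  w / z + (w / z)^-1 + w * z + (w * z)^-1 + 4 =
  ((1 + i * w) + i * z * (1 - i * w)) * ((1 - i * w) - i * z * (1 + i * w)) / (w * z).
Proof.
move=> i2 w0 z0.
have -> : ((1 + i * w) + i * z * (1 - i * w)) * ((1 - i * w) - i * z * (1 + i * w)) =
    (1 - i ^+ 2 * w ^+ 2) * (1 - i ^+ 2 * z ^+ 2) - 4 * i ^+ 2 * w * z by ring.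
by rewrite i2; field; rewrite w0 z0.
Qed.

(* With [w = - i c e^(is)], [z = d e^(it/2)], [x = w / z] and [y = w z], one has
   [A = 1 + i w], [B = 1 - i w], [w z Q4(x, y) = (A + i z B) (B - i z A)], and
   [F3] is [F2] at [- w]. *)
Let A c s : R[i] := 1 + c%:C * cexpi s.
Let B c s : R[i] := 1 - c%:C * cexpi s.
Let F1 c d s t : R := cmod (A c s + 'i * (d%:C * cexpi (t / 2)) * B c s).
Let F2 c d s t : R := cmod (B c s - 'i * (d%:C * cexpi (t / 2)) * A c s).
Let F3 c d s t : R := cmod (A c s - 'i * (d%:C * cexpi (t / 2)) * B c s).
Let F c d s t : R := cmod (A c s ^+ 2 + d%:C ^+ 2 * B c s ^+ 2 * cexpi t).

(** The offset [- pi / 2] in both angles is the factor [- i] of [w], chosen to make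
    [i w = c e^(is)]. *)
Let cmod_Q4 c d s t : 0 < c -> 0 < d ->
  cmod (Q4 ((c / d)%:C * cexpi (s - pi / 2 - t / 2)) ((c * d)%:C * cexpi (s - pi / 2 + t / 2))) =
  F1 c d s t * F2 c d s t / (c * d).
Proof.
move=> c0 d0; pose w : R[i] := - 'i * (c%:C * cexpi s); pose z : R[i] := d%:C * cexpi (t / 2).
have i2 : 'i ^+ 2 = -1 :> R[i] by exact: sqr_i.
have iV : 'i^-1 = - 'i :> R[i].
  have i0 : 'i != 0 :> R[i] by rewrite -cmod_gt0 cmod_i.
  by apply: (mulfI i0); rewrite mulfV// mulrN -expr2 i2 opprK.
have c0C : c%:C != 0 :> R[i] by rewrite fmorph_eq0 gt_eqF.
have d0C : d%:C != 0 :> R[i] by rewrite fmorph_eq0 gt_eqF.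
have w0 : w != 0.
  by rewrite -cmod_gt0 !cmodM cmodN cmod_i cmod_cexpi cmod_real ?(ltW c0)// mul1r mulr1.
have z0 : z != 0 by rewrite mulf_neq0// cexpi_neq0.
have -> : (c / d)%:C * cexpi (s - pi / 2 - t / 2) = w / z.
  rewrite !cexpiD !cexpiN cexpi_pihalf iV /w /z rmorphM fmorphV/=.
  by field; rewrite d0C cexpi_neq0.
have -> : (c * d)%:C * cexpi (s - pi / 2 + t / 2) = w * z.
  by rewrite !cexpiD !cexpiN cexpi_pihalf iV /w /z rmorphM; ring.
rewrite /Q4 (factor_identity i2 w0 z0) !cmodM cmodV [cmod (w * z)]cmodM.
have -> : cmod w = c by rewrite !cmodM cmodN cmod_i cmod_cexpi cmod_real ?(ltW c0)// mul1r mulr1.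
have -> : cmod z = d by rewrite cmodM cmod_cexpi cmod_real ?(ltW d0)// mulr1.
have iw : 'i * w = c%:C * cexpi s by rewrite /w mulrA mulrN -expr2 i2 opprK mul1r.
by rewrite iw.
Qed.

Let AE c s : A c s = 1 - c%:C * cexpi (s + pi).
Proof. by rewrite cexpiD cexpi_pi mulrN1 mulrN opprK. Qed.

Let cmod_A c s : cmod (A c s) = Num.sqrt (1 + c ^+ 2 + 2 * c * cos s).
Proof. by rewrite AE cmod_oneBpolar cosDpi mulrN opprK. Qed.

Let cmod_B c s : cmod (B c s) = Num.sqrt (1 + c ^+ 2 - 2 * c * cos s).
Proof. exact: cmod_oneBpolar. Qed.

Let cmod_A_le c s : 0 <= c -> cmod (A c s) <= 1 + c.
Proof.
move=> c0; apply: le_trans (cmodD_le _ _) _.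
by rewrite cmodM cmod_cexpi !cmod_real// mulr1.
Qed.

Let cmod_B_le c s : 0 <= c -> cmod (B c s) <= 1 + c.
Proof.
move=> c0; apply: le_trans (cmodD_le _ _) _.
by rewrite cmodN cmodM cmod_cexpi !cmod_real// mulr1.
Qed.

Let cmod_iz d t : 0 <= d -> cmod ('i * (d%:C * cexpi (t / 2))) = d.
Proof. by move=> d0; rewrite !cmodM cmod_i cmod_cexpi cmod_real// mul1r mulr1. Qed.

(** [|A|] and [|B|] are at most [1 + c] and [|i z| = d]; hence the constant [(1 + c) (1 + d)],
    common to [F1], [F2] and [F3]. *)
Let F1_bound c d s t : 0 <= c -> 0 <= d -> 0 <= F1 c d s t <= (1 + c) * (1 + d).
Proof.
move=> c0 d0; rewrite cmod_ge0/=; apply: le_trans (cmodD_le _ _) _.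
rewrite cmodM cmod_iz//; have := cmod_A_le s c0; have := cmod_B_le s c0.
by have := cmod_ge0 (B c s); nra.
Qed.

Let F2_bound c d s t : 0 <= c -> 0 <= d -> 0 <= F2 c d s t <= (1 + c) * (1 + d).
Proof.
move=> c0 d0; rewrite cmod_ge0/=; apply: le_trans (cmodD_le _ _) _.
rewrite cmodN cmodM cmod_iz//; have := cmod_A_le s c0; have := cmod_B_le s c0.
by have := cmod_ge0 (A c s); nra.
Qed.

Let F3_bound c d s t : 0 <= c -> 0 <= d -> 0 <= F3 c d s t <= (1 + c) * (1 + d).
Proof.
move=> c0 d0; rewrite cmod_ge0/=; apply: le_trans (cmodD_le _ _) _.
rewrite cmodN cmodM cmod_iz//; have := cmod_A_le s c0; have := cmod_B_le s c0.
by have := cmod_ge0 (B c s); nra.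
Qed.

(** [(A + i z B) (A - i z B) = A^2 + z^2 B^2] with [z^2 = d^2 e^(it)]: the product is affine in
    [e^(it)], as [integral_gap_affine] requires. *)
Let F13 c d s t : F1 c d s t * F3 c d s t = F c d s t.
Proof.
rewrite /F1 /F3 -cmodM; congr cmod.
set z := d%:C * _; have z2 : z ^+ 2 = d%:C ^+ 2 * cexpi t.
  by rewrite exprMn [cexpi _ ^+ 2]expr2 -cexpiD -mulrDl -mulr2n -[t *+ 2]mulr_natr mulfK.
have -> : d%:C ^+ 2 * B c s ^+ 2 * cexpi t = z ^+ 2 * B c s ^+ 2.
  by rewrite z2; ring.
transitivity (A c s ^+ 2 - 'i ^+ 2 * z ^+ 2 * B c s ^+ 2); first by ring.
by rewrite sqr_i; ring.
Qed.

(** Adding [pi] to [s] exchanges [A] and [B]. *)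
Let F2_shift c d s t : F2 c d (s + pi) t = F3 c d s t.
Proof.
by rewrite /F2 /F3 /A /B cexpiD cexpi_pi !(mulrN1, mulrN) !opprK.
Qed.

Let F2_periodic c d s t : F2 c d (s + 2 * pi) t = F2 c d s t.
Proof. by rewrite /F2 /A /B cexpi_periodic. Qed.

Let mA c : cmeasurable (fun w : R * R => A c w.1).
Proof.
apply: cmeasurableD; first exact: cmeasurable_cst.
apply: cmeasurableM; first exact: cmeasurable_cst.
by apply: cmeasurable_cexpi; exact: measurable_fst.
Qed.

Let mB c : cmeasurable (fun w : R * R => B c w.1).
Proof.
apply: cmeasurableD; first exact: cmeasurable_cst.
apply: cmeasurableN; apply: cmeasurableM; first exact: cmeasurable_cst.
by apply: cmeasurable_cexpi; exact: measurable_fst.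
Qed.

Let mZ d : cmeasurable (fun w : R * R => 'i * (d%:C * cexpi (w.2 / 2))).
Proof.
apply: cmeasurableM; first exact: cmeasurable_cst.
apply: cmeasurableM; first exact: cmeasurable_cst.
by apply: cmeasurable_cexpi; apply: measurable_funM => //; exact: measurable_snd.
Qed.

Let measurable_F1 c d : measurable_fun setT (fun w : R * R => F1 c d w.1 w.2).
Proof. by apply: measurable_cmod; apply: cmeasurableD => //; exact: cmeasurableM. Qed.

Let measurable_F2 c d : measurable_fun setT (fun w : R * R => F2 c d w.1 w.2).
Proof.
apply: measurable_cmod; apply: cmeasurableD => //.
by apply: cmeasurableN; exact: cmeasurableM.
Qed.

Let measurable_F3 c d : measurable_fun setT (fun w : R * R => F3 c d w.1 w.2).
Proof.
apply: measurable_cmod; apply: cmeasurableD => //.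
by apply: cmeasurableN; exact: cmeasurableM.
Qed.

Let measurable_F c d : measurable_fun setT (fun w : R * R => F c d w.1 w.2).
Proof.
apply: measurable_cmod; apply: cmeasurableD; first exact: cmeasurableM.
apply: cmeasurableM; last by apply: cmeasurable_cexpi; exact: measurable_snd.
by apply: cmeasurableM; [exact: cmeasurable_cst|exact: cmeasurableM].
Qed.

Let measurable_Q4 a b (sg tau : R * R -> R) :
  measurable_fun setT sg -> measurable_fun setT tau ->
  measurable_fun setT (fun w => cmod (Q4 (a%:C * cexpi (sg w)) (b%:C * cexpi (tau w)))).
Proof.
move=> msg mtau.
have mx : cmeasurable (fun w => a%:C * cexpi (sg w)).
  by apply: cmeasurableM; [exact: cmeasurable_cst|exact: cmeasurable_cexpi].
have my : cmeasurable (fun w => b%:C * cexpi (tau w)).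
  by apply: cmeasurableM; [exact: cmeasurable_cst|exact: cmeasurable_cexpi].
apply: measurable_cmod; apply: cmeasurableD; last exact: cmeasurable_cst.
apply: cmeasurableD; last exact: cmeasurableV.
by apply: cmeasurableD => //; apply: cmeasurableD => //; exact: cmeasurableV.
Qed.

Definition max_lncirc c d s : R := Num.max (lncirc c (s + pi)) (ln d + lncirc c s).

Let ln_cmod_A c s : ln (cmod (A c s)) = lncirc c (s + pi).
Proof. by rewrite AE lncircE. Qed.

Let ln_cmod_B c s : ln (cmod (B c s)) = lncirc c s.
Proof. exact: lncircE. Qed.

Lemma measurable_max_lncirc c d : measurable_fun setT (max_lncirc c d).
Proof.
apply: measurable_maxr; last by apply: measurable_funD => //; exact: measurable_lncirc.
by apply: (measurableT_comp (measurable_lncirc c)); exact: measurable_funD.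
Qed.

(** According to the sign of [cos s], one of [|A|], [|B|] is at least [1]. So the maximum is bounded
    below even near a zero of the other factor. *)
Lemma max_lncirc_bound c d s : 0 < c -> 0 < d ->
  `|max_lncirc c d s| <= ln (1 + c) + `|ln d|.
Proof.
move=> c0 d0; have lnc0 : 0 <= ln (1 + c) by apply: ln_ge0; lra.
have lnle v : 0 <= v <= 1 + c -> ln v <= ln (1 + c).
  move=> /andP[]; rewrite le_eqVlt => /predU1P[<- _|v0 vc]; first by rewrite ln0.
  by rewrite ler_ln ?posrE//; lra.
have lA : lncirc c (s + pi) <= ln (1 + c).
  by rewrite -ln_cmod_A lnle// cmod_ge0 cmod_A_le// ltW.
have lB : lncirc c s <= ln (1 + c).
  by rewrite -ln_cmod_B lnle// cmod_ge0 cmod_B_le// ltW.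
have AB : 0 <= lncirc c (s + pi) \/ 0 <= lncirc c s.
  have [cs|cs] := leP 0 (cos s); [left|right]; rewrite /lncirc ?cosDpi divr_ge0// ln_ge0//.
  - by have := mulr_ge0 (ltW c0) cs; have := sqr_ge0 c; nra.
  - by have : 0 <= c * - cos s; [rewrite mulr_ge0// ?ltW// oppr_gt0|have := sqr_ge0 c; nra].
have := ler_norm (ln d); have := ler_norm (- ln d); rewrite normrN => d1 d2.
rewrite /max_lncirc ler_norml ge_max le_max; apply/andP; split; last by apply/andP; split; lra.
by case: AB => h; apply/orP; [left|right]; lra.
Qed.

Lemma integrable_max_lncirc c d (x y : R) : 0 < c -> 0 < d ->
  mu.-integrable `[x, y] (EFin \o max_lncirc c d).
Proof.
move=> c0 d0; apply: integrable_itv_bounded; first exact: measurable_max_lncirc.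
by move=> s _; exact: max_lncirc_bound.
Qed.

(* Outside three values of [cos s], neither [A] nor [B] vanishes and
   [|A| <> d |B|]. *)
Let integral_gap_F c d : 0 < c -> 0 < d ->
  (\int[mu]_(s in I) \int[mu]_(t in I) gap ((1 + c) * (1 + d) * ((1 + c) * (1 + d))) (F c d s t) =
   \int[mu]_(s in I) (2 * pi * (2 * ln ((1 + c) * (1 + d)) - 2 * max_lncirc c d s))%:E)%E.
Proof.
move=> c0 d0; set K0 := (1 + c) * (1 + d); have K00 : 0 < K0 by rewrite mulr_gt0//; lra.
have gF0 (w : R * R) : (0 <= gap (K0 * K0) (F c d w.1 w.2))%E.
  rewrite -F13; apply: gap_ge0; first exact: mulr_gt0.
  have /andP[f10 f1K] := F1_bound w.1 w.2 (ltW c0) (ltW d0).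
  have /andP[f30 f3K] := F3_bound w.1 w.2 (ltW c0) (ltW d0).
  by apply/andP; split; [exact: mulr_ge0|exact: ler_pM].
have mgF : measurable_fun setT (fun w : R * R => gap (K0 * K0) (F c d w.1 w.2)).
  exact: measurable_gap.
apply: ae_eq_integral => //.
- apply: measurable_funTS.
  exact: (measurable_integral_section (f := fun w => gap (K0 * K0) (F c d w.1 w.2))).
- apply: measurable_funTS; apply/measurable_EFinP; apply: measurable_funM => //.
  apply: measurable_funB => //; apply: measurable_funM => //.
  exact: measurable_max_lncirc.
(* The three values are, in order, those for [A = 0], for [B = 0] and for [|A| = d |B|]; the last
   one is [- calA c d]. *)
apply: negligibleS (negligibleU (negligibleU
  (negligible_cos_eq (- (1 + c ^+ 2) / (2 * c))) (negligible_cos_eq ((1 + c ^+ 2) / (2 * c))))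
  (negligible_cos_eq ((1 + c ^+ 2) * (d ^+ 2 - 1) / (2 * c * (1 + d ^+ 2))))) => s /= Hs.
have Is : I s by apply: contrapT => nI; apply: Hs => /nI.
apply: contrapT => Hk; apply: Hs => _.
have k1 : cos s <> - (1 + c ^+ 2) / (2 * c) by move=> h; apply: Hk; left; left.
have k2 : cos s <> (1 + c ^+ 2) / (2 * c) by move=> h; apply: Hk; left; right.
have k3 : cos s <> (1 + c ^+ 2) * (d ^+ 2 - 1) / (2 * c * (1 + d ^+ 2)).
  by move=> h; apply: Hk; right.
have dd0 : 1 + d ^+ 2 != 0 by rewrite gt_eqF// addr_gt0// exprn_gt0.
have c2n0 : 2 * c != 0 by rewrite mulf_neq0// gt_eqF.
have vA0 : 0 <= 1 + c ^+ 2 + 2 * c * cos s.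
  by have := circ_ge (s + pi) (ltW c0); rewrite cosDpi; have := sqr_ge0 (1 - c); lra.
have vB0 : 0 <= 1 + c ^+ 2 - 2 * c * cos s.
  by have := circ_ge s (ltW c0); have := sqr_ge0 (1 - c); lra.
have A2 : cmod (A c s) ^+ 2 = 1 + c ^+ 2 + 2 * c * cos s by rewrite cmod_A sqr_sqrtr.
have B2 : cmod (B c s) ^+ 2 = 1 + c ^+ 2 - 2 * c * cos s by rewrite cmod_B sqr_sqrtr.
have A0 : A c s != 0.
  rewrite -cmod_eq0; apply/eqP => h; apply: k1; move: A2; rewrite h expr0n/= => h'.
  by apply: (mulIf c2n0); rewrite divfK//; lra.
have B0 : B c s != 0.
  rewrite -cmod_eq0; apply/eqP => h; apply: k2; move: B2; rewrite h expr0n/= => h'.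
  by apply: (mulIf c2n0); rewrite divfK//; lra.
have d0C : d%:C != 0 :> R[i] by rewrite fmorph_eq0 gt_eqF.
have cP : cmod (A c s ^+ 2) = cmod (A c s) ^+ 2 by rewrite !expr2 cmodM.
have cQ : cmod (d%:C ^+ 2 * B c s ^+ 2) = (d * cmod (B c s)) ^+ 2.
  by rewrite !expr2 !cmodM cmod_real ?(ltW d0)//; ring.
have cA0 : 0 < cmod (A c s) by rewrite cmod_gt0.
have cB0 : 0 < cmod (B c s) by rewrite cmod_gt0.
rewrite integral_gap_affine ?expf_neq0 ?mulf_neq0 ?expf_neq0//; last first.
  rewrite cP cQ exprMn A2 B2; apply/eqP => h; apply: k3.
  by apply: (mulIf (mulf_neq0 c2n0 dd0)); rewrite divfK ?mulf_neq0//; lra.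
rewrite cP cQ !lnXn ?mulr_gt0// [ln (d * _)]lnM ?posrE// ln_cmod_A ln_cmod_B.
have -> : Num.max (lncirc c (s + pi) *+ 2) ((ln d + lncirc c s) *+ 2) = 2 * max_lncirc c d s.
  by rewrite maxr_pMr// !mulr_natl.
by rewrite lnM ?posrE//; congr EFin; ring.
Qed.

Lemma mahler_Q4 c d : 0 < c -> 0 < d ->
  mahler (c / d) (c * d) Q4 =
  ((\int[mu]_(s in I) max_lncirc c d s) / pi - ln c - ln d)%:E.
Proof.
move=> c0 d0; have pi0 := @pi_gt0 R; have pi20 : 0 < 2 * pi :> R by rewrite mulr_gt0.
pose K0 := (1 + c) * (1 + d); have K00 : 0 < K0 by rewrite mulr_gt0//; lra.
(* A bound for [|Q4| = F1 F2 / (c d)]. The factor [(c * d)^-1] is kept apart so that [gapM] splits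
   it off with gap [0]. *)
pose K := K0 * K0 * (c * d)^-1.
have cd0 : 0 < c * d by rewrite mulr_gt0.
have K_gt0 : 0 < K by rewrite mulr_gt0 ?invr_gt0// mulr_gt0.
pose q (s t : R) : R := cmod (Q4 ((c / d)%:C * cexpi s) ((c * d)%:C * cexpi t)).
pose f (w : R * R) := gap K (q w.1 w.2).
have qF s t : q (s - pi / 2 - t / 2) (s - pi / 2 + t / 2) = F1 c d s t * F2 c d s t / (c * d).
  exact: cmod_Q4.
have fF s t : (f ((s - pi / 2 - t / 2)%R, (s - pi / 2 + t / 2)%R)
    = gap K0 (F1 c d s t) + gap K0 (F2 c d s t))%E.
  have /andP[f10 _] := F1_bound s t (ltW c0) (ltW d0).
  have /andP[f20 _] := F2_bound s t (ltW c0) (ltW d0).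
  have V : 0 < (c * d)^-1 by rewrite invr_gt0.
  rewrite /f /= qF (gapM (mulr_gt0 K00 K00) V (mulr_ge0 f10 f20) (ltW V)).
  by rewrite (gapM K00 K00 f10 f20) [gap (c * d)^-1 _]gap_EFin// subrr adde0.
have gF1 x y : (0 <= gap K0 (F1 c d x y))%E.
  by apply: gap_ge0 => //; exact: F1_bound x y (ltW c0) (ltW d0).
have gF2 x y : (0 <= gap K0 (F2 c d x y))%E.
  by apply: gap_ge0 => //; exact: F2_bound x y (ltW c0) (ltW d0).
have gF3 x y : (0 <= gap K0 (F3 c d x y))%E.
  by apply: gap_ge0 => //; exact: F3_bound x y (ltW c0) (ltW d0).
(* Any pair of angles [(u, v)] has the form used in [fF], with [t'] their difference and
   [s' - pi / 2] their mean. *)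
have f0 w : (0 <= f w)%E.
  move: w => [u v]; pose s' := (u + v) / 2 + pi / 2; pose t' := v - u.
  have -> : u = s' - pi / 2 - t' / 2 by rewrite /s' /t'; field.
  have -> : v = s' - pi / 2 + t' / 2 by rewrite /s' /t'; field.
  by rewrite fF adde_ge0.
have mI : measurable I by [].
have mfst : measurable_fun setT (fst : R * R -> R) := measurable_fst.
have msnd : measurable_fun setT (snd : R * R -> R) := measurable_snd.
have mq sg tau : measurable_fun setT sg -> measurable_fun setT tau ->
    measurable_fun setT (fun w : R * R => f (sg w, tau w)).
  by move=> ms mt; apply: measurable_gap; exact: measurable_Q4.
have mf : measurable_fun setT f by apply: measurable_gap; exact: measurable_Q4.
have mgF1 : measurable_fun setT (fun w : R * R => gap K0 (F1 c d w.1 w.2)) by exact: measurable_gap.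
have mgF2 : measurable_fun setT (fun w : R * R => gap K0 (F2 c d w.1 w.2)) by exact: measurable_gap.
have mgF3 : measurable_fun setT (fun w : R * R => gap K0 (F3 c d w.1 w.2)) by exact: measurable_gap.
have fP1 s t : f (s + 2 * pi, t) = f (s, t) by rewrite /f/= /q cexpi_periodic.
have fP2 s t : f (s, t + 2 * pi) = f (s, t) by rewrite /f/= /q cexpi_periodic.
(* The inner variable becomes the difference of the two angles. *)
have H2 s : s \in I -> (\int[mu]_(t in I) f (s, t) = \int[mu]_(t in I) f (s, (t + s)%R))%E.
  rewrite inE/= in_itv/= => sI.
  rewrite (ge0_integral_periodic_shift (f := fun t => f (s, t)) sI)//.
  exact: (measurable_fun_pair2 s mf).
(* At a fixed difference [t], the shift by [pi / 2 + t / 2], which lies within one period, produces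
   the angles of [cmod_Q4]. *)
have H4 t : t \in I -> (\int[mu]_(s in I) f (s, (t + s)%R) =
    \int[mu]_(s in I) gap (K0 * K0) (F c d s t))%E.
  rewrite inE/= in_itv/= => /andP[t0 t2].
  pose p s := f (s - pi / 2 - t / 2, s - pi / 2 + t / 2).
  have pE s : f (s, t + s) = p (s + (pi / 2 + t / 2)).
    have e1 : s + (pi / 2 + t / 2) - pi / 2 - t / 2 = s by ring.
    have e2 : s + (pi / 2 + t / 2) - pi / 2 + t / 2 = t + s by field.
    by rewrite /p e1 e2.
  under eq_integral do rewrite pE.
  rewrite (ge0_integral_periodic_shift (f := p)); last 4 first.
  - by apply/andP; split; lra.
  - have m1 : measurable_fun setT (fun w : R * R => w.1 - pi / 2 - t / 2).
      by apply: measurable_funB => //; exact: measurable_funB.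
    have m2 : measurable_fun setT (fun w : R * R => w.1 - pi / 2 + t / 2).
      by apply: measurable_funD => //; exact: measurable_funB.
    exact: (measurable_fun_pair1 (0 : R) (mq _ _ m1 m2)).
  - by move=> s; exact: f0.
  - move=> s; have e1 : s + 2 * pi - pi / 2 - t / 2 = s - pi / 2 - t / 2 + 2 * pi by ring.
    have e2 : s + 2 * pi - pi / 2 + t / 2 = s - pi / 2 + t / 2 + 2 * pi by ring.
    by rewrite /p e1 e2 fP1 fP2.
  under eq_integral do rewrite /p fF.
  rewrite ge0_integralD//; last 2 first.
  - by apply: measurable_funTS; exact: (measurable_fun_pair1 t mgF1).
  - by apply: measurable_funTS; exact: (measurable_fun_pair1 t mgF2).
  (* The substitution [w -> - w], applied to the second factor alone after the sum of gaps has been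
     split. *)
  rewrite -(ge0_integral_periodic_shift (f := fun s => gap K0 (F2 c d s t)) (s := pi)); last 4 first.
  - by apply/andP; split; lra.
  - exact: (measurable_fun_pair1 t mgF2).
  - by [].
  - by move=> s; rewrite F2_periodic.
  under [X in (_ + X)%E]eq_integral do rewrite F2_shift.
  rewrite -ge0_integralD//; last 2 first.
  - by apply: measurable_funTS; exact: (measurable_fun_pair1 t mgF1).
  - by apply: measurable_funTS; exact: (measurable_fun_pair1 t mgF3).
  apply: eq_integral => s _; rewrite -F13 gapM//; exact: cmod_ge0.
have gF0 (w : R * R) : (0 <= gap (K0 * K0) (F c d w.1 w.2))%E.
  by rewrite -F13 gapM ?cmod_ge0// adde_ge0.
have mgF : measurable_fun setT (fun w : R * R => gap (K0 * K0) (F c d w.1 w.2)).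
  exact: measurable_gap.
have V : (\int[mu \x mu]_(w in I `*` I) f w =
    (2 * pi * (2 * ln K0 * (2 * pi) - 2 * \int[mu]_(s in I) max_lncirc c d s))%:E)%E.
  rewrite (ge0_integral_rect mI mI mf f0).1.
  under eq_integral => s sI do rewrite (H2 s sI).
  have f0' w : (0 <= f (w.1, (w.2 + w.1)%R))%E by exact: f0.
  rewrite (ge0_integral_rect mI mI (mq fst (fun w => w.2 + w.1) mfst (measurable_funD msnd mfst)) f0').2.
  under eq_integral => t tI do rewrite (H4 t tI).
  rewrite -(ge0_integral_rect mI mI mgF gF0).2 integral_gap_F//.
  have Im := integrable_max_lncirc 0 (2 * pi) c0 d0.
  transitivity (\int[mu]_(s in I)
      (2 * pi * (2 * ln K0) + - (4 * pi) * max_lncirc c d s)%:E)%E.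
    by apply: eq_integral => s _; congr EFin; rewrite /K0; ring.
  by rewrite integral_add_scale//; congr EFin; ring.
have mII : measurable (I `*` I : set (R * R)) by exact: measurableX.
(* Integrability is deduced from the finite value [V], the integrand being nonnegative. *)
have If : (mu \x mu)%E.-integrable (I `*` I) f.
  apply/integrableP; split; first exact: measurable_funTS.
  under eq_integral do rewrite gee0_abs//.
  by rewrite V ltry.
have muII : (mu \x mu)%E (I `*` I) = ((2 * pi) * (2 * pi))%:E.
  rewrite [LHS](@product_measure1E _ _ _ _ R mu mu I I)//= !lebesgue_measure_itv/= !lte_fin.
  by rewrite pi20 sube0.
have IK : (mu \x mu)%E.-integrable (I `*` I) (EFin \o (fun=> ln K)).
  apply: measurable_bounded_integrable.
  - exact: measurableX.
  - by have := ltry (2 * pi * (2 * pi) : R); rewrite -muII.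
  - exact: measurable_cst.
  - exists `|ln K|; split; first exact: num_real.
    by move=> M hM x _; exact: ltW.
rewrite /mahler.
transitivity (((2 * pi) ^- 2)%:E *
   \int[mu \x mu]_(w in I `*` I) ((EFin \o (fun=> ln K)) w - f w))%E.
  congr (_ * _)%E; apply: eq_integral => w _.
  by rewrite [in LHS](@lneE_gap _ K).
rewrite (@integralB _ _ R (mu \x mu)%E (I `*` I) (measurableX mI mI) _ _ IK If) V.
rewrite (@integral_cst _ _ R (mu \x mu)%E (I `*` I) (measurableX mI mI) (ln K)%:E).
rewrite [X in (_ * (_ * X - _))%E]muII.
rewrite -EFinM; congr EFin.
(* The auxiliary [K0] cancels against the value [V]; what remains, [- ln c - ln d], comes from the
   division by [w z]. *)
have -> : ln K = 2 * ln K0 - (ln c + ln d).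
  have -> : ln K = ln (K0 * K0) + ln (c * d)^-1.
    by apply: lnM; rewrite posrE ?invr_gt0//; exact: mulr_gt0.
  rewrite lnV ?posrE// (lnM (x := c) (y := d))// (lnM (x := K0) (y := K0))//.
  by ring.
move: (Rintegral _ _ _) pi0 => J; move: (@pi R) => p p0.
by field; rewrite gt_eqF.
Qed.

End Reduction.

(** * Evaluation of the circle integral of the maximum *)

Section ArcIntegrals.
Context {R : realType}.
Local Notation mu := (@lebesgue_measure R).
Implicit Types (c d s : R).

(** Endpoints are excluded because for [c = 1] one of the two factors vanishes at the angle [0] or
    [pi], where [ln 0 = 0] can falsify the comparison. *)
Lemma eq_Rintegral_oo (a b : R) (f g : R -> R) :
  measurable_fun setT f -> measurable_fun setT g -> {in `]a, b[, f =1 g} ->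
  \int[mu]_(x in `[a, b]) f x = \int[mu]_(x in `[a, b]) g x.
Proof.
move=> mf mg fg; rewrite /Rintegral; congr fine.
apply: eq_integral_itv_bounded => //.
- exact: measurable_funTS.
- exact: measurable_funTS.
Qed.

Let calAE c d : 0 < c -> 0 < d ->
  calA c d * (2 * c * (1 + d ^+ 2)) = (1 - d ^+ 2) * (1 + c ^+ 2).
Proof.
move=> c0 d0; rewrite /calA; field.
by rewrite gt_eqF//= gt_eqF// addr_gt0// exprn_gt0.
Qed.

Let lncirc_pi c s : lncirc c (s + pi) = ln (1 + c ^+ 2 + 2 * c * cos s) / 2.
Proof. by rewrite /lncirc cosDpi mulrN opprK. Qed.

Let ln_d_lncirc c d s : 0 < d -> 0 < 1 + c ^+ 2 - 2 * c * cos s ->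
  ln d + lncirc c s = ln (d ^+ 2 * (1 + c ^+ 2 - 2 * c * cos s)) / 2.
Proof.
move=> d0 v0; rewrite lnM ?posrE ?exprn_gt0// lnXn// /lncirc mulr2n.
by field.
Qed.

(** [|A|^2 >= d^2 |B|^2] is an affine inequality in [cos s], and clearing the denominators of [calA]
    turns it into [cos s >= - calA c d]. *)
Lemma max_lncirc_l c d s : 0 < c -> 0 < d ->
  0 < 1 + c ^+ 2 + 2 * c * cos s -> 0 < 1 + c ^+ 2 - 2 * c * cos s ->
  - calA c d <= cos s -> max_lncirc c d s = lncirc c (s + pi).
Proof.
move=> c0 d0 v1 v2 h; apply: max_l; rewrite lncirc_pi ln_d_lncirc//.
rewrite ler_pM2r ?invr_gt0// ler_ln ?posrE ?mulr_gt0 ?exprn_gt0//.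
have D0 : 0 < 2 * c * (1 + d ^+ 2) by rewrite !mulr_gt0// addr_gt0// exprn_gt0.
by rewrite -(ler_pM2r D0) mulNr calAE// in h; lra.
Qed.

Lemma max_lncirc_r c d s : 0 < c -> 0 < d ->
  0 < 1 + c ^+ 2 + 2 * c * cos s -> 0 < 1 + c ^+ 2 - 2 * c * cos s ->
  cos s <= - calA c d -> max_lncirc c d s = ln d + lncirc c s.
Proof.
move=> c0 d0 v1 v2 h; apply: max_r; rewrite lncirc_pi ln_d_lncirc//.
rewrite ler_pM2r ?invr_gt0// ler_ln ?posrE ?mulr_gt0 ?exprn_gt0//.
have D0 : 0 < 2 * c * (1 + d ^+ 2) by rewrite !mulr_gt0// addr_gt0// exprn_gt0.
by rewrite -(ler_pM2r D0) mulNr calAE// in h; lra.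
Qed.

(** At [c = 1] the second factor of [calA] is [1], while the first always lies strictly between [-1]
    and [1]. *)
Lemma calA_ge1_neq1 c d : 0 < d -> 1 <= `|calA c d| -> c != 1.
Proof.
move=> d0; apply: contraTneq => ->; rewrite -ltNge.
have d2 : 0 < d ^+ 2 by rewrite exprn_gt0.
rewrite /calA (_ : (1 + 1 ^+ 2) / (2 * 1) = 1 :> R); last by field.
rewrite mulr1 ltr_norml ltr_pdivlMr ?ltr_pdivrMr ?addr_gt0//.
by apply/andP; split; lra.
Qed.

Let circ_both_gt0 c s : 0 < c -> c != 1 ->
  0 < 1 + c ^+ 2 + 2 * c * cos s /\ 0 < 1 + c ^+ 2 - 2 * c * cos s.
Proof.
move=> c0 c1; have q : 0 < (1 - c) ^+ 2 by rewrite exprn_even_gt0//= subr_eq0 eq_sym.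
have := circ_ge (s + pi) (ltW c0); rewrite cosDpi => h1; have := circ_ge s (ltW c0) => h2.
by split; lra.
Qed.

Lemma Rintegral_max_lncirc_ge1 c d : 0 < c -> 0 < d -> 1 <= `|calA c d| ->
  \int[mu]_(s in `[0, 2 * pi]) max_lncirc c d s =
  2 * pi * (Num.max 0 (ln c) + Num.max 0 (ln d)).
Proof.
move=> c0 d0 A1; have c1 := calA_ge1_neq1 d0 A1; have pi0 := @pi_gt0 R.
have D0 : 0 < 2 * c * (1 + d ^+ 2) by rewrite !mulr_gt0// addr_gt0// exprn_gt0.
have c2 : 0 < 1 + c ^+ 2 by rewrite addr_gt0// exprn_gt0.
have Ae := calAE c0 d0.
move: A1; rewrite ler_normr => /orP[A1|A1].
(* The sign of [calA] is that of [1 - d ^+ 2]; here the term without [ln d] dominates and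
   [Num.max 0 (ln d)] is [0]. *)
- have d1 : d <= 1.
    have : 0 <= (1 - d ^+ 2) * (1 + c ^+ 2) by rewrite -Ae mulr_ge0//; [lra|exact: ltW].
    by rewrite pmulr_lge0// => h; rewrite leNgt; apply/negP => d1; nra.
  under eq_Rintegral => s _.
    have [v1 v2] := circ_both_gt0 s c0 c1.
    rewrite max_lncirc_l//; last by have := cos_geN1 s; lra.
    over.
  have -> : \int[mu]_(s in `[0, 2 * pi]) lncirc c (s + pi) =
      \int[mu]_(s in `[0, 2 * pi]) lncirc c s.
    rewrite /Rintegral (@integral_periodic_shift _ (2 * pi) pi (EFin \o lncirc c))//.
    - by apply/andP; split; lra.
    - by apply/measurable_EFinP; exact: measurable_lncirc.
    - move=> s /=; have -> // : lncirc c (s + 2 * pi) = lncirc c s.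
      by rewrite /lncirc [2 * pi]mulr_natl cosD2pi.
  rewrite Rintegral_lncirc//.
  by rewrite [Num.max 0 (ln d)]max_l ?addr0// -ln1 ler_ln ?posrE.
- have d1 : 1 <= d.
    have : (1 - d ^+ 2) * (1 + c ^+ 2) <= 0.
      by rewrite -Ae -oppr_ge0 -mulNr mulr_ge0//; [lra|exact: ltW].
    by rewrite pmulr_lle0// => h; rewrite leNgt; apply/negP => d1; nra.
  under eq_Rintegral => s _.
    have [v1 v2] := circ_both_gt0 s c0 c1.
    rewrite max_lncirc_r//; last by have := cos_le1 s; lra.
    over.
  rewrite RintegralD//; last 2 first.
  + by apply: (@integrable_itv_bounded _ _ _ `|ln d|).
  + exact: integrable_lncirc (ltW c0) c1.
  rewrite Rintegral_lncirc// Rintegral_cst//= lebesgue_measure_itv/= lte_fin mulr_gt0//.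
  by rewrite sube0/= [Num.max 0 (ln d)]max_r ?ln_ge0//; ring.
Qed.

(** The integrand is symmetric about [pi], hence the factor [2]. On [[0, pi]] the terms cross at
    [pi / 2 + m], whose cosine is [- sin m = - calA c d]; the reflection [s -> pi - s] moves the
    first arc to [[pi / 2 - m, pi]]. *)
Lemma Rintegral_max_lncirc_lt1 c d : 0 < c -> 0 < d -> `|calA c d| < 1 ->
  let m := asin (calA c d) in
  \int[mu]_(s in `[0, 2 * pi]) max_lncirc c d s =
  2 * (\int[mu]_(t in `[pi / 2 - m, pi]) lncirc c t +
       \int[mu]_(t in `[pi / 2 + m, pi]) lncirc c t + (pi / 2 - m) * ln d).
Proof.
move=> c0 d0; rewrite ltr_norml => A1 m; have pi0 := @pi_gt0 R; have [AN1 A_1] := andP A1.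
have m1 : m < pi / 2 by apply: asin_ltpi2; rewrite (ltW AN1).
have m2 : - (pi / 2) < m by apply: asin_gtNpi2; rewrite AN1 ltW.
have sm : sin m = calA c d by rewrite asinK// in_itv/= !ltW.
have mM := measurable_max_lncirc c d; have mL := measurable_lncirc c.
have IM x y := integrable_max_lncirc x y c0 d0.
have c01 s : s \in `]0, pi[ -> -1 < cos s < 1.
  rewrite in_itv/= => /andP[s0 s1]; rewrite -[X in _ < _ < X]cos0 -cospi.
  by rewrite !ltr_cos ?in_itv/= ?lexx ?ltW//= ?s0 ?s1.
have vv s : s \in `]0, pi[ -> 0 < 1 + c ^+ 2 + 2 * c * cos s /\ 0 < 1 + c ^+ 2 - 2 * c * cos s.
  move=> /c01/andP[h1 h2]; have := sqr_ge0 (1 - c).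
  have : 0 < c * (1 + cos s) by rewrite mulr_gt0//; lra.
  have : 0 < c * (1 - cos s) by rewrite mulr_gt0//; lra.
  by split; nra.
have cb : cos (pi / 2 + m) = - calA c d by rewrite addrC cosDpihalf sm.
rewrite (@Rintegral_itv_split _ _ pi)//; last by apply/andP; split; lra.
have -> : \int[mu]_(x in `[pi, 2 * pi]) max_lncirc c d x =
    \int[mu]_(x in `[0, pi]) max_lncirc c d x.
  rewrite -[RHS](@Rintegral_reflect _ (2 * pi))//.
  rewrite subr0 (_ : 2 * pi - pi = pi); last by ring.
  apply: eq_Rintegral => x _; rewrite /max_lncirc /lncirc !cosDpi.
  have -> : cos (2 * pi - x) = cos x.
    by rewrite cosB mulr_natl cos2pi sin2pi; ring.
  by [].
rewrite (@Rintegral_itv_split _ 0 (pi / 2 + m) pi)//; last by apply/andP; split; lra.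
have -> : \int[mu]_(x in `[0, pi / 2 + m]) max_lncirc c d x =
    \int[mu]_(t in `[pi / 2 - m, pi]) lncirc c t.
  rewrite -[RHS](@Rintegral_reflect _ pi)// subrr.
  rewrite (_ : pi - (pi / 2 - m) = pi / 2 + m); last by field.
  apply: eq_Rintegral_oo => //.
    by apply: (measurableT_comp mL); exact: measurable_funB.
  move=> s; rewrite in_itv/= => /andP[s0 sm1].
  have [|v1 v2] := vv s; first by rewrite in_itv/= s0/=; lra.
  rewrite max_lncirc_l//; last first.
    by rewrite -cb leNgt ltr_cos ?in_itv/= -?leNgt; [lra|apply/andP; split; lra|apply/andP; split; lra].
  by rewrite /lncirc cosDpi cosB cospi sinpi; congr (ln _ / _); ring.
have -> : \int[mu]_(x in `[pi / 2 + m, pi]) max_lncirc c d x =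
    \int[mu]_(x in `[pi / 2 + m, pi]) (ln d + lncirc c x).
  apply: eq_Rintegral_oo => //; first exact: measurable_funD.
  move=> s; rewrite in_itv/= => /andP[s0 sm1].
  have [|v1 v2] := vv s; first by rewrite in_itv/= sm1 andbT; lra.
  rewrite max_lncirc_r//.
  by rewrite -cb leNgt ltr_cos ?in_itv/= -?leNgt; [lra|apply/andP; split; lra|apply/andP; split; lra].
rewrite RintegralD//; last 2 first.
- by apply: (@integrable_itv_bounded _ _ _ `|ln d|).
- by apply: integrable_lncirc_arc => //; apply/andP; split; lra.
rewrite Rintegral_cst//= lebesgue_measure_itv/= lte_fin ifT; last by lra.
by rewrite -EFinB/=; field.
Qed.

End ArcIntegrals.

(** * The arctangent in the closed form *)

Section ArcTangent.
Context {R : realType}.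
Implicit Types (c x y m : R).

(** [x * y < 1] makes the cosine of the sum positive, so the sum lies in []- pi / 2, pi / 2[], where
    [atan] inverts [tan]. *)
Lemma atanD x y : x * y < 1 -> atan x + atan y = atan ((x + y) / (1 - x * y)).
Proof.
move=> xy; have pi0 := @pi_gt0 R.
have x1 := atan_gtNpi2 x; have x2 := atan_ltpi2 x.
have y1 := atan_gtNpi2 y; have y2 := atan_ltpi2 y.
have cpos z : 0 < cos (atan z) by apply: cos_gt0_pihalf; rewrite atan_gtNpi2 atan_ltpi2.
have s_atan z : sin (atan z) = z * cos (atan z).
  by rewrite -{2}(atanK z) /tan divfK// gt_eqF// cpos.
have cD : 0 < cos (atan x + atan y).
  rewrite cosD !s_atan.
  have -> : cos (atan x) * cos (atan y) - x * cos (atan x) * (y * cos (atan y)) =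
    cos (atan x) * cos (atan y) * (1 - x * y) by ring.
  by apply: mulr_gt0; [apply: mulr_gt0; exact: cpos|rewrite subr_gt0].
have lt_pihalf u : 0 < cos u -> u < pi -> u < pi / 2.
  move=> cu u_pi; rewrite ltNge; apply/negP => u2.
  have : 0 <= cos (u - pi) by apply: cos_ge0_pihalf; apply/andP; split; lra.
  by rewrite cosB cospi sinpi; lra.
rewrite -[LHS]tanK; last first.
  rewrite in_itv/=; apply/andP; split; last by apply: lt_pihalf => //; lra.
  by rewrite ltrNl; apply: lt_pihalf; [rewrite cosN|lra].
by rewrite tanD ?gt_eqF ?cpos// !atanK.
Qed.

(** The half angles [p] and [pi / 2 - p] are complementary, so the arctangents are those of
    [k cot p] and [k tan p], with product [k ^+ 2 < 1]; [atanD] and [2 sin p cos p = cos m] do the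
    rest. This merges the argument terms of the two Bloch-Wigner values. *)
Lemma circarg_sum c m : 0 < c -> - (pi / 2) < m < pi / 2 ->
  circarg c (pi / 2 - m) + circarg c (pi / 2 + m) =
  pi / 2 + atan ((c - c^-1) / (2 * cos m)).
Proof.
move=> c0 /andP[m1 m2]; have pi0 := @pi_gt0 R.
pose p := (pi / 2 - m) / 2.
have S0 : 0 < sin p by apply: sin_gt0_pi; apply/andP; split; rewrite /p; lra.
have C0 : 0 < cos p by apply: cos_gt0_pihalf; apply/andP; split; rewrite /p; lra.
have E : (pi / 2 + m) / 2 = - (p - pi / 2) by rewrite /p; field.
have CS : cos p ^+ 2 + sin p ^+ 2 = 1 by exact: cos2Dsin2.
have cm : cos m = 2 * cos p * sin p.
  have -> : m = - (p *+ 2 - pi / 2) by rewrite /p mulr2n; field.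
  by rewrite cosN cosBpihalf sin_mulr2n mulr2n; ring.
have c1 : 0 < 1 + c by lra.
rewrite /circarg E cosN sinN cosBpihalf sinBpihalf opprK -/p.
set k := (1 - c) / (1 + c).
have k1 : 1 - k ^+ 2 = 4 * c / (1 + c) ^+ 2 by rewrite /k; field; rewrite gt_eqF.
have k0 : 0 < 1 - k ^+ 2 by rewrite k1 divr_gt0 ?mulr_gt0 ?exprn_gt0.
have kk : k * (cos p / sin p) * (k * (sin p / cos p)) = k ^+ 2.
  by field; rewrite !gt_eqF.
have -> : (pi - (pi / 2 - m)) / 2 - atan (k * (cos p / sin p)) +
    ((pi - (pi / 2 + m)) / 2 - atan (k * (sin p / cos p))) =
    pi / 2 - (atan (k * (cos p / sin p)) + atan (k * (sin p / cos p))) by field.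
rewrite atanD kk; last by rewrite -subr_gt0.
rewrite -atanN; congr (_ + atan _).
have -> : k * (cos p / sin p) + k * (sin p / cos p) =
    k * ((cos p ^+ 2 + sin p ^+ 2) / (cos p * sin p)).
  by field; rewrite !gt_eqF.
rewrite CS cm k1 /k; field.
by rewrite !gt_eqF.
Qed.

End ArcTangent.

Theorem theorem1p4 (R : realType) (a b : R) (ha : 0 < a) (hb : 0 < b) :
  let c : R := Num.sqrt (a * b) in
  let d : R := Num.sqrt (b / a) in
  let mu : R := asin (calA c d) in
  (1 <= `|calA c d| ->
     mahler a b Q4 =
     (Num.max (ln c) (- ln c) + Num.max (ln d) (- ln d))%:E) /\
  (`|calA c d| < 1 ->
     - (pi / 2) < mu < pi / 2 /\
     mahler a b Q4 =
     (2 / pi *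
        (BlochWigner ('i%C * c%:C * cexpi (- mu))
         + BlochWigner ('i%C * c%:C * cexpi mu)
         - mu * ln d
         + ln c * atan ((c - c^-1) / (2 * cos mu))))%:E).
Proof.
move=> c d mu; have pi0 := @pi_gt0 R; have pin0 : pi != 0 :> R by rewrite gt_eqF.
have c0 : 0 < c by rewrite sqrtr_gt0 mulr_gt0.
have d0 : 0 < d by rewrite sqrtr_gt0 divr_gt0.
have sb0 : Num.sqrt b != 0 by rewrite gt_eqF// sqrtr_gt0.
have sa0 : Num.sqrt a != 0 by rewrite gt_eqF// sqrtr_gt0.
have sqa : Num.sqrt a ^+ 2 = a by rewrite sqr_sqrtr// ltW.
have sqb : Num.sqrt b ^+ 2 = b by rewrite sqr_sqrtr// ltW.
have cE : c = Num.sqrt a * Num.sqrt b by rewrite /c sqrtrM// ltW.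
have dE : d = Num.sqrt b / Num.sqrt a by rewrite /d sqrtrM ?sqrtrV// ltW.
have cd_a : c / d = a.
  by rewrite -[RHS]sqa cE dE; field; rewrite sa0 sb0.
have cd_b : c * d = b by rewrite -[RHS]sqb cE dE; field.
have := mahler_Q4 c0 d0; rewrite cd_a cd_b => ->.
(* The terms [- ln c - ln d] of [mahler_Q4] are absorbed by this identity. *)
have maxE (x : R) : Num.max x (- x) = 2 * Num.max 0 x - x.
  by case: (leP 0 x) => x0; [rewrite max_l|rewrite max_r]; lra.
split=> [A1|A1].
  rewrite Rintegral_max_lncirc_ge1// !maxE; congr EFin.
  move: (@pi R) pin0 => p p0; by field.
have mu12 : - (pi / 2) < mu < pi / 2.
  move: A1; rewrite ltr_norml => /andP[AN1 A1].
  by apply/andP; split; [apply: asin_gtNpi2|apply: asin_ltpi2]; apply/andP; split=> //; exact: ltW.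
split=> //; have [mu1 mu2] := andP mu12.
(* The two points have angles [pi / 2 - mu] and [pi / 2 + mu], inside []0, pi[], and these are the
   lower ends of the two arcs. *)
have polar x : 'i%C * c%:C * cexpi x = c%:C * cexpi (pi / 2 + x).
  by rewrite cexpiD cexpi_pihalf mulrA [_ * 'i]mulrC.
rewrite !polar !BlochWigner_polar//; last 2 first.
- by apply/andP; split; lra.
- by apply/andP; split; lra.
rewrite Rintegral_max_lncirc_lt1//= -/mu; congr EFin.
have := circarg_sum c0 mu12.
set T := atan _; set h1 := circarg _ _; set h2 := circarg _ _ => h12.
(* In [h1 + h2], [T] cancels the explicit arctangent term and [pi / 2] yields [- ln c]; the [- ln d]
   of [mahler_Q4] cancels against [(pi / 2) * ln d] from the second arc. *)
have -> : h1 = pi / 2 + T - h2 by rewrite -h12; ring.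
move: (Rintegral _ _ _) (Rintegral _ _ _) => S1 S2.
move: (ln c) (ln d) => lc ld; clear - pin0.
move: (@pi R) pin0 => p p0; by field.
Qed.
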